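(* Let $\mathcal{J}_c$ be the norm closed (two-sided) ideal of $\operatorname{Alg}\mathcal{N}$ generated by the compact elements of $\operatorname{Alg}\mathcal{N}$. Then $\mathcal{J}_c=\mathcal{K}(\mathcal{N})+\operatorname{Rad}(\mathcal{N})$.
   Context: $\mathcal{N}$ is a nest on a Hilbert space $H$: a totally ordered family of closed subspaces of $H$ containing $\{0\}$ and $H$ and closed under intersections and closed linear spans of arbitrary subfamilies. $\operatorname{Alg}\mathcal{N}$ is the algebra of all bounded operators $T$ on $H$ with $T(N)\subseteq N$ for all $N\in\mathcal{N}$. $\mathcal{K}(\mathcal{N})$ is the ideal of all compact operators belonging to $\operatorname{Alg}\mathcal{N}$, and $\operatorname{Rad}(\mathcal{N})$ is the Jacobson radical of $\operatorname{Alg}\mathcal{N}$. An element $a$ of a Banach algebra $\mathcal{A}$ is called a compact element of $\mathcal{A}$ if the map $\mathcal{A}\to\mathcal{A}$, $x\mapsto axa$, is a compact linear map (this need not mean that $a$ is a compact operator). *)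

(* Defs.v *)
From HB Require Import structures.
From mathcomp Require Import all_boot all_order all_algebra.
From mathcomp Require Import complex.
From mathcomp Require Import all_classical all_reals all_analysis.

Set Implicit Arguments.
Unset Strict Implicit.
Unset Printing Implicit Defensive.

Import Order.TTheory GRing.Theory Num.Theory.
Import numFieldNormedType.Exports.

Local Open Scope classical_set_scope.
Local Open Scope ring_scope.
Local Open Scope complex_scope.

Definition linear_subspace (K : pzRingType) (V : lmodType K) (M : set V) :=
  [/\ M 0, forall x y, M x -> M y -> M (x + y) & forall c x, M x -> M (c *: x)].

Definition closed_span (K : numFieldType) (V : normedModType K) (S : set V) :=
  closure (smallest (@linear_subspace K V) S).

(** [f], restricted to the subspace [A], maps the closed unit ball of [A] to a
    relatively compact set. *)
Definition compact_map_on (K : numFieldType) (V W : normedModType K)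
    (A : set V) (f : V -> W) :=
  precompact (f @` [set x | A x /\ `|x| <= 1]).

Section BoundedOperators.
Variables (R : realType) (H : normedModType R[i]).

Definition bounded_operator : {pred H -> H} :=
  [pred f | `[< linear f /\ exists M : R[i], forall x, `|f x| <= M * `|x| >]].

Lemma bounded_operator_submod : submod_closed bounded_operator.
Proof.
split.
  apply/asboolP; split; first by move=> c x y; rewrite /= scaler0 addr0.
  by exists 0 => x; rewrite normr0 mul0r.
move=> c f g /asboolP[lf [M fM]] /asboolP[lg [N gN]]; apply/asboolP; split.
  move=> d x y.
  rewrite !fctE lf lg !scalerDr !scalerA (mulrC c) !addrA; congr (_ + _).
  by rewrite -!addrA; congr (_ + _); rewrite addrC.
exists (`|c| * M + N) => x; rewrite mulrDl.
apply: (le_trans (ler_normD _ _)); apply: lerD; last exact: gN.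
by rewrite normrZ -mulrA ler_wpM2l.
Qed.

HB.instance Definition _ := GRing.isSubmodClosed.Build R[i] (H -> H)
  bounded_operator bounded_operator_submod.

(** The space B(H) of bounded operators on [H]. *)
Record bop := Bop { bop_fun :> H -> H; _ : bop_fun \in bounded_operator }.

HB.instance Definition _ := [isSub for bop_fun].
HB.instance Definition _ := [Choice of bop by <:].
HB.instance Definition _ := [SubChoice_isSubLmodule of bop by <:].

Lemma bopP (S T : bop) : S =1 T -> S = T.
Proof. by move=> ST; apply/val_inj/funext. Qed.

Lemma bop_linear (T : bop) : linear T.
Proof. by have /asboolP[] := valP T. Qed.

Lemma bop_bounded (T : bop) : exists M, forall x, `|T x| <= M * `|x|.
Proof. by have /asboolP[] := valP T. Qed.

HB.instance Definition _ (T : bop) :=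
  GRing.isLinear.Build R[i] H H _ T (bop_linear T).

Lemma bop_id_subproof : idfun \in bounded_operator.
Proof. by apply/asboolP; split=> //; exists 1 => x; rewrite mul1r. Qed.

Lemma bop_comp_subproof (S T : bop) : S \o T \in bounded_operator.
Proof.
apply/asboolP; split; first by move=> c x y; rewrite /= !linearP.
have [M SM] := bop_bounded S; have [N TN] := bop_bounded T.
exists (`|M| * N) => x; apply: le_trans (SM _) _.
have [x0|x0] := eqVneq (T x) 0.
  rewrite /= x0 normr0 mulr0 -mulrA mulr_ge0//.
  by apply: le_trans (TN x).
apply: (@le_trans _ _ (`|M| * `|T x|)); last by rewrite -mulrA ler_wpM2l.
rewrite ler_wpM2r// ger0_norm//.
have := le_trans (normr_ge0 _) (SM (T x)).
by rewrite pmulr_lge0// normr_gt0.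
Qed.

Definition bop1 := Bop bop_id_subproof.
Definition bop_comp S T := Bop (bop_comp_subproof S T).

Let compA : associative bop_comp. Proof. by move=> *; apply: bopP. Qed.
Let comp1 : left_id bop1 bop_comp. Proof. by move=> *; apply: bopP. Qed.
Let compr1 : right_id bop1 bop_comp. Proof. by move=> *; apply: bopP. Qed.
Let compDl : left_distributive bop_comp +%R.
Proof. by move=> *; apply: bopP. Qed.
Let compDr : right_distributive bop_comp +%R.
Proof. by move=> S T U; apply: bopP => x /=; rewrite /= linearD. Qed.

(** Multiplication is composition: [(S * T) x = S (T x)].  The ring is not
    required to be nonzero, so [H] may be the zero space. *)
HB.instance Definition _ :=
  GRing.Zmodule_isPzRing.Build bop compA comp1 compr1 compDl compDr.

(** The operator norm.  Norms of [normedModType R[i]] are [R[i]]-valued,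
    whence the projection to and the injection from the reals. *)
Definition opnorm (T : bop) : R[i] :=
  (sup [set complex.Re `|T x| | x in [set x : H | `|x| <= 1]])%:C.

Lemma ge0_ReK (z : R[i]) : 0 <= z -> (complex.Re z)%:C = z.
Proof. by move=> z0; exact: RRe_real (ger0_real z0). Qed.

Lemma ge0_Re_le (z w : R[i]) : 0 <= z -> 0 <= w ->
  (complex.Re z <= complex.Re w) = (z <= w).
Proof.
by move=> z0 w0; rewrite -[in RHS](ge0_ReK z0) -[in RHS](ge0_ReK w0) lecR.
Qed.

Lemma opnorm_has_sup (T : bop) :
  has_sup [set complex.Re `|T x| | x in [set x : H | `|x| <= 1]].
Proof.
split; first by exists (complex.Re `|T 0|), 0 => //=; rewrite normr0.
have [M TM] := bop_bounded T; exists (complex.Re `|M|) => _ [x /= x1 <-].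
rewrite (ge0_Re_le (normr_ge0 _) (normr_ge0 M)).
have [->|x0] := eqVneq x 0; first by rewrite linear0 normr0.
have M0 : 0 <= M.
  by have := le_trans (normr_ge0 _) (TM x); rewrite pmulr_lge0// normr_gt0.
by apply: le_trans (TM x) _; rewrite ger0_norm// ler_piMr.
Qed.

Lemma le_opnorm_ball (T : bop) x : `|x| <= 1 -> `|T x| <= opnorm T.
Proof.
move=> x1; rewrite -(ge0_ReK (normr_ge0 (T x))) lecR.
by apply: ub_le_sup; [have [] := opnorm_has_sup T|exists x].
Qed.

Lemma opnorm_ge0 T : 0 <= opnorm T.
Proof. by apply: le_trans (@le_opnorm_ball T 0 _); rewrite ?normr0. Qed.

Lemma le_opnorm (T : bop) x : `|T x| <= opnorm T * `|x|.
Proof.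
have [->|x0] := eqVneq x 0; first by rewrite linear0 normr0 mulr0.
have nx0 : 0 < `|x| by rewrite normr_gt0.
rewrite -ler_pdivrMr// mulrC -[X in X * _]ger0_norm ?invr_ge0//.
rewrite -normrZ -linearZ; apply: le_opnorm_ball.
by rewrite normrZ ger0_norm ?invr_ge0// mulVf// gt_eqF.
Qed.

Lemma opnorm_le (T : bop) (c : R[i]) : 0 <= c ->
  (forall x, `|x| <= 1 -> `|T x| <= c) -> opnorm T <= c.
Proof.
move=> c0 Tc; rewrite -(ge0_ReK c0) lecR.
apply: ge_sup => [|_ [x /= x1 <-]]; first by have [] := opnorm_has_sup T.
by rewrite (ge0_Re_le (normr_ge0 _) c0); exact: Tc.
Qed.

Let opnormD S T : opnorm (S + T) <= opnorm S + opnorm T.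
Proof.
apply: opnorm_le => [|x x1]; first by rewrite addr_ge0// opnorm_ge0.
by apply: le_trans (ler_normD _ _) _; rewrite lerD// le_opnorm_ball.
Qed.

Let opnormZ_le c T : opnorm (c *: T) <= `|c| * opnorm T.
Proof.
apply: opnorm_le => [|x x1]; first by rewrite mulr_ge0// opnorm_ge0.
by rewrite normrZ ler_wpM2l// le_opnorm_ball.
Qed.

Let opnormZ c T : opnorm (c *: T) = `|c| * opnorm T.
Proof.
apply/eqP; rewrite eq_le opnormZ_le/=.
have [->|c0] := eqVneq c 0; first by rewrite normr0 mul0r opnorm_ge0.
rewrite -ler_pdivlMl ?normr_gt0// -normfV.
by apply: le_trans (opnormZ_le _ _); rewrite scalerA mulVf// scale1r.
Qed.

Let opnorm0 T : opnorm T = 0 -> T = 0.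
Proof.
move=> T0; apply: bopP => x; apply/eqP; rewrite -normr_le0.
by apply: le_trans (le_opnorm _ _) _; rewrite T0 mul0r.
Qed.

HB.instance Definition _ :=
  Lmodule_isNormed.Build R[i] bop opnormD opnormZ opnorm0.

Lemma bop_normE (T : bop) : `|T| = opnorm T. Proof. by []. Qed.

End BoundedOperators.

Section Ideals.
Variables (R : realType) (H : normedModType R[i]).
Implicit Types (A I J M : set (bop H)).

(** Below [A] is (the underlying set of) a unital subalgebra of B(H). *)
Definition left_ideal A I :=
  [/\ I `<=` A, linear_subspace I & forall a x, A a -> I x -> I (a * x)].

Definition two_sided_ideal A I :=
  left_ideal A I /\ forall a x, A a -> I x -> I (x * a).

Definition maximal_left_ideal A M :=
  [/\ left_ideal A M, M <> A &
      forall I, left_ideal A I -> M `<=` I -> I = M \/ I = A].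

Definition jacobson_radical A : set (bop H) :=
  [set a | A a /\ forall M, maximal_left_ideal A M -> M a].

Definition compact_elements A : set (bop H) :=
  [set a | A a /\ compact_map_on A (fun x => a * x * a)].

(** [A] is meant to be norm closed in B(H), so that being closed or relatively
    compact means the same in [A] and in B(H); see [nest_alg_closed]. *)
Definition closed_ideal_generated A (G : set (bop H)) : set (bop H) :=
  smallest [set J | closed J /\ two_sided_ideal A J] G.

End Ideals.

Section Nests.
Variables (R : realType) (H : normedModType R[i]).

Record nest (Ns : set (set H)) : Prop := {
  nest_subspace : forall N, Ns N -> linear_subspace N;
  nest_closed : forall N, Ns N -> closed N;
  nest_total : forall M N, Ns M -> Ns N -> M `<=` N \/ N `<=` M;
  nest0 : Ns [set 0];
  nestT : Ns [set: H];
  nest_bigcap : forall F, F `<=` Ns -> Ns (\bigcap_(N in F) N);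
  nest_closed_span : forall F, F `<=` Ns ->
    Ns (closed_span (\bigcup_(N in F) N)) }.

Definition nest_alg (Ns : set (set H)) : set (bop H) :=
  [set T | forall N, Ns N -> T @` N `<=` N].

Definition nest_compact (Ns : set (set H)) : set (bop H) :=
  [set T | nest_alg Ns T /\ compact_map_on [set: H] T].

Lemma nest_alg_closed (Ns : set (set H)) : nest Ns -> closed (nest_alg Ns).
Proof.
move=> nNs T clT N NN _ [x Nx <-]; apply: (nest_closed nNs NN) => B.
move=> /nbhs_ballP[e /= e0 eB].
have d0 : 0 < e / (`|x| + 1) by rewrite divr_gt0// ltr_wpDl.
have [S [NS]] := clT _ (nbhsx_ballx T _ d0).
rewrite -ball_normE /= => TS; exists (S x); split; first by apply: (NS _ NN); exists x.
apply: eB; rewrite -ball_normE /=.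
have := le_opnorm (T - S) x; rewrite -bop_normE => /le_lt_trans; apply.
apply: (@le_lt_trans _ _ (`|T - S| * (`|x| + 1))).
  by rewrite ler_wpM2l// lerDl.
by rewrite -ltr_pdivlMr// ltr_wpDl.
Qed.

End Nests.

(* Main.v *)
Require Import Defs.
From mathcomp Require Import all_boot all_order all_algebra.
From mathcomp Require Import complex.
From mathcomp Require Import all_classical all_reals all_analysis.
From mathcomp Require Import ring lra zify.

Set Implicit Arguments.
Unset Strict Implicit.
Unset Printing Implicit Defensive.

Import Order.TTheory GRing.Theory Num.Theory.
Import numFieldNormedType.Exports.

Local Open Scope classical_set_scope.
Local Open Scope ring_scope.
Local Open Scope complex_scope.

(** Write [E] for the projection onto an interval [N - M] of the nest, and say
    that an estimate on [E T E] holds locally if each point of the nest has,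
    on either side, an adjacent interval where it holds; the nest being
    complete, it then holds on the cells of a finite partition.  Let [J] be the
    set of those [T] such that for each [e] some compact [K] in the algebra has
    [||E (T - K) E|| <= e] locally; [J] is clearly a closed ideal.

    If the estimate [||E a E|| <= d] fails on every interval with endpoint [N],
    and [N] is a limit of the nest on that side, choose successive intervals
    and vectors [x_k], [z_k] in them with [<a x_k, z_k> = 1].  The rank one
    operators [x_i (x) z_j], [i < j] (or [j < i]), belong to the algebra.  The
    operators [a (x_k (x) z_(k+1)) a] are then uniformly separated, so that
    [a] is not a compact element; and after thinning out the sequence, [1 - S a]
    is not bounded below for [S = sum_k x_k (x) z_(k+1)], so that [a] is not in
    the radical.  On a gap of the nest, [E a E] is compact if [a] is a compact
    element, and zero if [a] is in the radical.  Hence compact elements belong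
    to [J], and [||E T E||] is locally small if [T] is in the radical.

    If [T] is in [J], block diagonal corrections of geometrically decreasing
    norm lead to one compact [K] such that [||E (T - K) E||] is locally small,
    and this puts [T - K] in the radical: with [X = S (T - K)], the operator
    [1 - X] is block triangular with invertible diagonal blocks.  Conversely, a
    compact operator is a compact element, and an element of the radical is up
    to [e] a finite sum of operators [b = P X E] with [b s b = 0] for all [s] in
    the algebra, which are compact elements. *)

(** * Real-valued norms and sequential convergence *)

Section RealNorm.
Variable R : realType.

(** Norms take values in the partially ordered [R[i]]; their real parts lie in the ordered field
    [R], where [lra] can do the estimates. *)
Definition rnorm (V : normedZmodType R[i]) (x : V) : R := complex.Re `|x|.

Section Zmod.
Variable V : normedZmodType R[i].
Implicit Types x y : V.

Lemma rnormE x : `|x| = (rnorm x)%:C.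
Proof. exact: (esym (ge0_ReK (normr_ge0 x))). Qed.

Lemma rnorm_ge0 x : 0 <= rnorm x.
Proof. by rewrite -lecR -rnormE; exact: normr_ge0. Qed.

Lemma rnorm0 : rnorm (0 : V) = 0.
Proof. by rewrite /rnorm normr0. Qed.

Lemma rnorm_eq0 x : (rnorm x == 0) = (x == 0).
Proof. by rewrite -[in RHS]normr_eq0 rnormE -(inj_eq (@complexI R)). Qed.

Lemma rnorm0_eq0 x : rnorm x = 0 -> x = 0.
Proof. by move/eqP; rewrite rnorm_eq0 => /eqP. Qed.

Lemma rnorm_gt0 x : (0 < rnorm x) = (x != 0).
Proof. by rewrite lt_def rnorm_eq0 rnorm_ge0 andbT. Qed.

Lemma rnormD x y : rnorm (x + y) <= rnorm x + rnorm y.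
Proof. by rewrite -lecR rmorphD /= -!rnormE ler_normD. Qed.

Lemma rnormN x : rnorm (- x) = rnorm x.
Proof. by rewrite /rnorm normrN. Qed.

Lemma rnormB x y : rnorm (x - y) <= rnorm x + rnorm y.
Proof. by rewrite -[rnorm y]rnormN rnormD. Qed.

Lemma rdistC x y : rnorm (x - y) = rnorm (y - x).
Proof. by rewrite -rnormN opprB. Qed.

Lemma rdistD z x y : rnorm (x - y) <= rnorm (x - z) + rnorm (z - y).
Proof. by rewrite (le_trans _ (rnormD _ _))// addrA subrK. Qed.

Lemma rnorm_sum (I : Type) (r : seq I) (P : pred I) (F : I -> V) :
  rnorm (\sum_(i <- r | P i) F i) <= \sum_(i <- r | P i) rnorm (F i).
Proof.
elim/big_ind2 : _ => //[|x a y b xa yb]; first by rewrite rnorm0.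
by apply: le_trans (rnormD _ _) _; exact: lerD.
Qed.

End Zmod.

Lemma rnormM (z w : R[i]) : rnorm (z * w) = rnorm z * rnorm w.
Proof. by apply: (@complexI R); rewrite rmorphM /= -!rnormE normrM. Qed.

Lemma rnormZ (V : normedModType R[i]) (z : R[i]) (x : V) :
  rnorm (z *: x) = rnorm z * rnorm x.
Proof. by apply: (@complexI R); rewrite rmorphM /= -!rnormE normrZ. Qed.

Lemma rnorm_real (a : R) : rnorm (a%:C : R[i]) = `|a|.
Proof.
by apply: (@complexI R); rewrite -rnormE normc_def /= expr0n /= addr0 sqrtr_sqr.
Qed.

Lemma rnorm_conj (z : R[i]) : rnorm (z^*)%C = rnorm z.
Proof. by rewrite /rnorm normcJ. Qed.

End RealNorm.

Lemma half_pow_lt (R : realType) (e : R) : 0 < e ->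
  exists N, forall n, (N <= n)%N -> 2^-1 ^+ n < e.
Proof.
move=> e0; have [N _ NP] : \forall n \near \oo, (2^-1 : R) ^+ n < e.
  by apply: (cvgr_lt _ (cvg_expr _)) => //; rewrite ger0_norm; lra.
by exists N => n /NP.
Qed.

Section Metric.
Variables (R : realType) (V : normedModType R[i]).
Implicit Types (x y : V) (A : set V) (u : nat -> V).

Lemma rballE x (e : R) y : ball x e%:C y <-> rnorm (x - y) < e.
Proof. by rewrite -ball_normE /= rnormE ltcR. Qed.

Lemma nbhs_rball x (B : set V) :
  nbhs x B <-> exists2 e : R, 0 < e & forall y, rnorm (x - y) < e -> B y.
Proof.
split=> [/nbhs_ballP[e /= e0 eB]|[e e0 eB]].
  have eE := ge0_ReK (ltW e0).
  exists (complex.Re e) => [|y xy]; first by rewrite -ltcR eE.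
  by apply: eB; rewrite -eE; apply/rballE.
by apply/nbhs_ballP; exists e%:C => [|y /rballE/eB//]; rewrite /= ltcR.
Qed.

Lemma closureP A x :
  closure A x <-> forall e : R, 0 < e -> exists2 y, A y & rnorm (x - y) < e.
Proof.
split=> [clA e e0|clA B /nbhs_rball[e e0 eB]].
  have [|y [Ay xy]] := clA [set y | rnorm (x - y) < e].
    by apply/nbhs_rball; exists e.
  by exists y.
by have [y Ay /eB By] := clA _ e0; exists y.
Qed.

Lemma closedP A :
  closed A <-> forall x, (forall e : R, 0 < e -> exists2 y, A y & rnorm (x - y) < e) -> A x.
Proof.
split=> cA x; first by move=> /closureP; exact: cA.
by move=> /closureP; exact: cA.
Qed.

Definition rcauchy u := forall e : R, 0 < e ->
  exists N, forall m n, (N <= m)%N -> (N <= n)%N -> rnorm (u m - u n) < e.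

Definition rcvg u l := forall e : R, 0 < e ->
  exists N, forall n, (N <= n)%N -> rnorm (u n - l) < e.

Definition rcomplete := forall u, rcauchy u -> exists l, rcvg u l.

Lemma rcvg_closed A u l : closed A -> (forall n, A (u n)) -> rcvg u l -> A l.
Proof.
move=> /closedP cA Au ul; apply: cA => e /ul[N uN]; exists (u N) => //.
by rewrite rdistC uN.
Qed.

Lemma rcvg_rnorm_le u l (c : R) :
  rcvg u l -> (exists N, forall n, (N <= n)%N -> rnorm (u n) <= c) -> rnorm l <= c.
Proof.
move=> ul [N0 uc]; apply/ler_addgt0Pr => e e0; have [N uN] := ul _ e0.
have := uN _ (leq_maxl N N0); have := uc _ (leq_maxr N N0).
set n := maxn _ _; rewrite rdistC; have := rnormD (l - u n) (u n).
by rewrite subrK; lra.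
Qed.

Lemma rcvg_unique u l l' : rcvg u l -> rcvg u l' -> l = l'.
Proof.
move=> ul ul'; apply/eqP; rewrite -subr_eq0 -rnorm_eq0 eq_le rnorm_ge0 andbT.
apply/ler_addgt0Pr => e e0; have e2 : 0 < e / 2 by lra.
have [N uN] := ul _ e2; have [M uM] := ul' _ e2.
have := uN _ (leq_maxl N M); have := uM _ (leq_maxr N M).
have := rdistD (u (maxn N M)) l l'; rewrite [rnorm (l - u _)]rdistC; lra.
Qed.

Lemma rcvgD u v a b : rcvg u a -> rcvg v b -> rcvg (fun n => u n + v n) (a + b).
Proof.
move=> ua vb e e0; have e2 : 0 < e / 2 by lra.
have [N uN] := ua _ e2; have [M vM] := vb _ e2; exists (maxn N M) => n.
rewrite geq_max => /andP[/uN + /vM]; rewrite opprD addrACA.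
have := rnormD (u n - a) (v n - b); lra.
Qed.

Lemma rcvgZ (c : R[i]) u a : rcvg u a -> rcvg (fun n => c *: u n) (c *: a).
Proof.
move=> ua e e0; have d0 : 0 < rnorm c + 1 by rewrite ltr_wpDl ?rnorm_ge0.
have [N uN] := ua _ (divr_gt0 e0 d0); exists N => n /uN.
rewrite -scalerBr rnormZ ltr_pdivlMr// mulrC; apply: le_lt_trans.
by rewrite ler_wpM2r ?rnorm_ge0// lerDl.
Qed.

Lemma rcvg_subr u a b : rcvg u a -> rcvg (fun n => u n - b) (a - b).
Proof.
by move=> ua e /ua[N uN]; exists N => n /uN; rewrite opprB addrA subrK.
Qed.

(** Peeling off the first step reproduces the bound: the step from [m] costs [c * 2^-1 ^+ m] and the
    rest, by induction, at most [2 * c * 2^-1 ^+ m.+1], which is the same amount. *)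
Lemma geom_rcauchy u (c : R) : (forall n, rnorm (u n.+1 - u n) <= c * 2^-1 ^+ n) ->
  forall m n, (m <= n)%N -> rnorm (u n - u m) <= 2 * c * 2^-1 ^+ m.
Proof.
move=> uc m n /subnK <-; move: (n - m)%N => d; elim: d m => [|d IH] m.
  have := le_trans (rnorm_ge0 _) (uc m).
  by rewrite subrr rnorm0; lra.
have := le_trans (rnorm_ge0 _) (uc m).
have := rdistD (u m.+1) (u (d + m.+1)%N) (u m).
have := IH m.+1; have := uc m; rewrite exprS addSnnS; lra.
Qed.

Lemma geom_rcvg u (c : R) : rcomplete ->
  (forall n, rnorm (u n.+1 - u n) <= c * 2^-1 ^+ n) ->
  exists l, rcvg u l /\ forall n, rnorm (u n - l) <= 2 * c * 2^-1 ^+ n.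
Proof.
move=> cV uc; have gc := geom_rcauchy uc.
have [l ul] : exists l, rcvg u l.
  apply: cV => e e0.
  have c0 : 0 <= c by have := le_trans (rnorm_ge0 _) (uc 0%N); rewrite expr0 mulr1.
  have [N Ne] : exists N, 4 * c * 2^-1 ^+ N < e.
    have ec : 0 < e / (4 * c + 1) by rewrite divr_gt0//; lra.
    have [N /(_ N (leqnn _))] := half_pow_lt ec.
    rewrite ltr_pdivlMr => [h|]; last lra.
    exists N; apply: le_lt_trans h; rewrite mulrC ler_wpM2l ?exprn_ge0//; lra.
  exists N => m n Nm Nn; have := gc _ _ Nm; have := gc _ _ Nn.
  have := rdistD (u N) (u m) (u n); rewrite [rnorm (u N - _)]rdistC; lra.
exists l; split=> // n; rewrite rdistC.
have := @rcvg_rnorm_le (fun k => u k - u n) (l - u n) (2 * c * 2^-1 ^+ n).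
apply; first exact: rcvg_subr.
by exists n => k; exact: gc.
Qed.

End Metric.

Lemma complete_rcomplete (R : realType) (V : completeNormedModType R[i]) : rcomplete V.
Proof.
move=> u cu; have : cvg (u @ \oo).
  apply/cauchy_cvgP/cauchy_exP => e e0.
  have eE := ge0_ReK (ltW e0).
  have [|N uN] := cu (complex.Re e); first by rewrite -ltcR eE.
  exists (u N); exists N => //= n Nn.
  by rewrite -eE; apply/rballE/uN.
move=> /cvg_ex[l ul]; exists l => e e0.
have [N _ uN] : nbhs \oo (u @^-1` (ball l e%:C)).
  by apply: ul; apply: nbhsx_ballx; rewrite ltcR.
by exists N => n /uN /rballE; rewrite rdistC.
Qed.

(** * Hilbert space geometry *)

Section Subspaces.
Variables (K : pzRingType) (V : lmodType K) (M : set V).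
Hypothesis sM : linear_subspace M.

Lemma subspaceB x y : M x -> M y -> M (x - y).
Proof.
by have [_ MD MZ] := sM => Mx My; apply: MD => //; rewrite -scaleN1r; exact: MZ.
Qed.

Lemma subspace_sum (I : Type) (r : seq I) (P : pred I) (F : I -> V) :
  (forall i, P i -> M (F i)) -> M (\sum_(i <- r | P i) F i).
Proof. by have [M0 MD _] := sM => MF; elim/big_ind : _. Qed.

End Subspaces.

(** In a chain, two summands lie together in the larger of their two members. *)
Lemma chain_union_subspace (K : pzRingType) (V : lmodType K) (F : set (set V)) :
  F !=set0 -> (forall M, F M -> linear_subspace M) ->
  (forall M N, F M -> F N -> M `<=` N \/ N `<=` M) ->
  linear_subspace (\bigcup_(M in F) M).
Proof.
move=> [M0 FM0] sF tF; split.
- by exists M0 => //; have [] := sF _ FM0.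
- move=> x y [M FM Mx] [N FN Ny].
  have [MN|NM] := tF _ _ FM FN.
    by exists N => //; have [_ ND _] := sF _ FN; apply: ND => //; exact: MN.
  by exists M => //; have [_ MD _] := sF _ FM; apply: MD => //; exact: NM.
- by move=> c x [M FM Mx]; exists M => //; have [_ _ MZ] := sF _ FM; exact: MZ.
Qed.

Section InnerProduct.
Variables (R : realType) (H : completeNormedModType R[i]).
Variables (ip : {dot H for Num.conj}) (ip_norm : forall x : H, ip x x = `|x| ^+ 2).
Implicit Types (x y z : H) (M : set H).

Lemma ipC x y : ip x y = ((ip y x)^*)%C.
Proof. by rewrite hermC /= expr0 mul1r. Qed.

Lemma ipDl x y z : ip (x + y) z = ip x z + ip y z.
Proof. exact: linearDl. Qed.

Lemma ipNl x z : ip (- x) z = - ip x z.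
Proof. exact: linearNl. Qed.

Lemma ipBl x y z : ip (x - y) z = ip x z - ip y z.
Proof. by rewrite ipDl ipNl. Qed.

Lemma ipZl c x z : ip (c *: x) z = c * ip x z.
Proof. exact: linearZl_LR. Qed.

Lemma ip0l z : ip 0 z = 0.
Proof. by rewrite -(scale0r (0 : H)) ipZl mul0r. Qed.

Lemma ipDr x y z : ip z (x + y) = ip z x + ip z y.
Proof. by rewrite ipC ipDl rmorphD /= -!ipC. Qed.

Lemma ipNr x z : ip z (- x) = - ip z x.
Proof. by rewrite ipC ipNl rmorphN /= -!ipC. Qed.

Lemma ipBr x y z : ip z (x - y) = ip z x - ip z y.
Proof. by rewrite ipDr ipNr. Qed.

Lemma ipZr c x z : ip z (c *: x) = (c^*)%C * ip z x.
Proof. by rewrite ipC ipZl rmorphM /= -!ipC. Qed.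

Lemma ip0r z : ip z 0 = 0.
Proof. by rewrite ipC ip0l conjc0. Qed.

Lemma ip_suml (I : Type) (r : seq I) (P : pred I) (F : I -> H) z :
  ip (\sum_(i <- r | P i) F i) z = \sum_(i <- r | P i) ip (F i) z.
Proof.
by elim/big_rec2 : _ => [|i y x _ <-]; rewrite ?ip0l ?ipDl.
Qed.

Lemma ip_eq0C x y : ip x y = 0 -> ip y x = 0.
Proof. by rewrite ipC => /eqP; rewrite conjc_eq0 => /eqP. Qed.

Lemma ipxx x : ip x x = (rnorm x ^+ 2)%:C.
Proof. by rewrite ip_norm rnormE rmorphXn. Qed.

Lemma sqr_rnormD x y :
  rnorm (x + y) ^+ 2 = rnorm x ^+ 2 + rnorm y ^+ 2 + 2 * complex.Re (ip x y).
Proof.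
apply: (@complexI R); rewrite -ipxx ipDl !ipDr !ipxx (ipC y x).
rewrite [RHS]rmorphD [X in _ = X + _]rmorphD /=.
have -> : (2 * complex.Re (ip x y))%:C = ip x y + ((ip x y)^*)%C.
  by rewrite addcJ rmorphM /= rmorph_nat.
by rewrite -!addrA; congr (_ + _); rewrite addrA addrC.
Qed.

Lemma sqr_rnormB x y :
  rnorm (x - y) ^+ 2 = rnorm x ^+ 2 + rnorm y ^+ 2 - 2 * complex.Re (ip x y).
Proof. by rewrite sqr_rnormD rnormN ipNr raddfN /= mulrN. Qed.

Lemma pythagoras x y : ip x y = 0 ->
  rnorm (x + y) ^+ 2 = rnorm x ^+ 2 + rnorm y ^+ 2.
Proof. by move=> xy; rewrite sqr_rnormD xy /= mulr0 addr0. Qed.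

Lemma pythagoras_le x y : ip x y = 0 -> rnorm x <= rnorm (x + y).
Proof.
move=> /pythagoras xy; rewrite -(@ler_pXn2r _ 2)// ?nnegrE ?rnorm_ge0// xy lerDl.
exact: sqr_ge0.
Qed.

Lemma parallelogram x y :
  rnorm (x + y) ^+ 2 + rnorm (x - y) ^+ 2 = 2 * rnorm x ^+ 2 + 2 * rnorm y ^+ 2.
Proof. by rewrite sqr_rnormB sqr_rnormD; ring. Qed.

(** The point subtracted is the one nearest to [x] on the line through [y]. That the left side is
    nonnegative is the Cauchy-Schwarz inequality; that it cannot drop below the distance to a
    subspace gives orthogonality in [projection_theorem]. *)
Lemma sqr_dist_line x y : y != 0 ->
  rnorm (x - (ip x y / (rnorm y ^+ 2)%:C) *: y) ^+ 2 =
  rnorm x ^+ 2 - rnorm (ip x y) ^+ 2 / rnorm y ^+ 2.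
Proof.
move=> y0; have ny : rnorm y != 0 by rewrite rnorm_eq0.
have -> : ((rnorm y ^+ 2)%:C)^-1 = (rnorm y ^- 2)%:C :> R[i] by rewrite fmorphV.
rewrite sqr_rnormB rnormZ ipZr rnormM rnorm_real ger0_norm; last first.
  by rewrite invr_ge0 sqr_ge0.
set c := ip x y.
have -> : ((c * (rnorm y ^- 2)%:C)^*)%C * c = (rnorm c ^+ 2 / rnorm y ^+ 2)%:C.
  have -> : ((c * (rnorm y ^- 2)%:C)^*)%C = (c^*)%C * (rnorm y ^- 2)%:C.
    by rewrite -[in RHS]conjc_real; exact: rmorphM.
  rewrite [RHS]rmorphM mulrAC; congr (_ * _).
  by rewrite mulrC -sqr_normc rnormE rmorphXn.
by rewrite [complex.Re _]/=; field.
Qed.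

Lemma cauchy_schwarz x y : rnorm (ip x y) <= rnorm x * rnorm y.
Proof.
have [->|y0] := eqVneq y 0; first by rewrite ip0r !rnorm0 mulr0.
have := sqr_ge0 (rnorm (x - (ip x y / (rnorm y ^+ 2)%:C) *: y)).
rewrite sqr_dist_line// subr_ge0 ler_pdivrMr ?exprn_gt0 ?rnorm_gt0//.
by rewrite -exprMn ler_pXn2r// nnegrE ?mulr_ge0 ?rnorm_ge0.
Qed.

Lemma ip_eq0 x : ip x x = 0 -> x = 0.
Proof.
rewrite ipxx => /(@complexI R _ 0)/eqP; rewrite expf_eq0/= => /eqP.
exact: rnorm0_eq0.
Qed.

(** A minimizing sequence is Cauchy: the midpoint of [u m] and [u n] lies in [M], so it is no closer
    to [x] than the infimum, and the parallelogram law then bounds the distance between the two. *)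
Lemma nearest_point M x : linear_subspace M -> closed M ->
  exists2 p, M p & forall m, M m -> rnorm (x - p) ^+ 2 <= rnorm (x - m) ^+ 2.
Proof.
move=> sM cM; have [M0 MD MZ] := sM.
set S := [set rnorm (x - m) ^+ 2 | m in M].
have S0 : has_inf S.
  split; first by exists (rnorm (x - 0) ^+ 2), 0.
  by exists 0 => _ [m _ <-]; exact: sqr_ge0.
have infS m : M m -> inf S <= rnorm (x - m) ^+ 2.
  by move=> Mm; apply: ge_inf; [case: S0|exists m].
have /choice[u uP] n : exists m, M m /\ rnorm (x - m) ^+ 2 < inf S + n.+1%:R^-1.
  have n0 : (0 : R) < n.+1%:R^-1 by rewrite invr_gt0.
  have [_ [m Mm <-] mS] := inf_adherent n0 S0.
  by exists m.
have uu m n : rnorm (u m - u n) ^+ 2 <= 2 * m.+1%:R^-1 + 2 * n.+1%:R^-1.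
  have [Mm um] := uP m; have [Mn un] := uP n.
  have := parallelogram (x - u m) (x - u n).
  rewrite [x - u m - _](_ : _ = u n - u m); last first.
    by rewrite opprB addrC subrKA.
  rewrite (_ : x - u m + (x - u n) = (2 : R)%:C *: (x - (2^-1 : R)%:C *: (u m + u n))); last first.
    rewrite scalerBr scalerA -rmorphM /= mulfV// rmorph1 scale1r.
    by rewrite rmorph_nat scaler_nat mulr2n opprD addrACA.
  rewrite rnormZ rnorm_real ger0_norm// exprMn (rdistC (u n)).
  have := infS _ (MZ (2^-1 : R)%:C _ (MD _ _ Mm Mn)).
  move: um un; set a := m.+1%:R^-1; set b := n.+1%:R^-1.
  by rewrite [2 ^+ 2]expr2; lra.
have [p up] : exists p, rcvg u p.
  apply: complete_rcomplete => e e0.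
  have e2 : 0 < e ^+ 2 / 4 by rewrite divr_gt0// exprn_gt0.
  have [N _ Ne] := near_infty_natSinv_lt (PosNum e2).
  exists N => m n /Ne /= hm /Ne /= hn.
  rewrite -(@ltr_pXn2r _ 2)// ?nnegrE ?rnorm_ge0 ?ltW//.
  apply: le_lt_trans (uu m n) _; move: hm hn.
  by set a := m.+1%:R^-1; set b := n.+1%:R^-1; lra.
have Mp : M p by apply: (rcvg_closed cM _ up) => n; case: (uP n).
exists p => // m Mm; apply: le_trans (infS _ Mm).
apply/ler_addgt0Pr => e e0.
have S00 : 0 <= inf S by apply: lb_le_inf; [case: S0|move=> _ [k _ <-]; exact: sqr_ge0].
(* The limit lemma bounds norms rather than their squares, hence the square root of the relaxed
   infimum. *)
set d := Num.sqrt (inf S + e).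
have dE : d ^+ 2 = inf S + e by rewrite sqr_sqrtr//; lra.
rewrite -dE ler_pXn2r ?nnegrE ?rnorm_ge0 ?sqrtr_ge0//.
rewrite rdistC; apply: (@rcvg_rnorm_le _ _ (fun n => u n - x) (p - x)).
  exact: rcvg_subr.
have [N _ Ne] := near_infty_natSinv_lt (PosNum e0).
exists N => n /Ne /= hn; rewrite -(@ler_pXn2r _ 2)// ?nnegrE ?rnorm_ge0 ?sqrtr_ge0//.
rewrite dE rdistC; have [_] := uP n; move: hn.
by set a := n.+1%:R^-1; lra.
Qed.

(** Moving the nearest point along [m] by the optimal amount stays in [M] and would reduce the
    distance by the square of [ip (x - p) m], suitably scaled; so this product vanishes. *)
Lemma projection_theorem M x : linear_subspace M -> closed M ->
  exists2 p, M p & forall m, M m -> ip (x - p) m = 0.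
Proof.
move=> sM cM; have [_ MD MZ] := sM.
have [p Mp pmin] := nearest_point x sM cM; exists p => // m Mm.
have [->|m0] := eqVneq m 0; first by rewrite ip0r.
have := pmin _ (MD _ _ Mp (MZ (ip (x - p) m / (rnorm m ^+ 2)%:C) _ Mm)).
rewrite opprD addrA sqr_dist_line// lerDl oppr_ge0 pmulr_lle0; last first.
  by rewrite invr_gt0 exprn_gt0 ?rnorm_gt0.
by rewrite exprn_even_le0//= rnorm_eq0 => /eqP.
Qed.

End InnerProduct.

(** * Bounded operators and projections *)

Section BopNorm.
Variables (R : realType) (H : normedModType R[i]).
Implicit Types (S T : bop H) (x y : H).

Lemma bopDE S T x : (S + T) x = S x + T x. Proof. by []. Qed.
Lemma bopNE T x : (- T) x = - T x. Proof. by []. Qed.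
Lemma bopBE S T x : (S - T) x = S x - T x. Proof. by []. Qed.
Lemma bopZE c T x : (c *: T) x = c *: T x. Proof. by []. Qed.
Lemma bopME S T x : (S * T) x = S (T x). Proof. by []. Qed.
Lemma bop1E x : (1 : bop H) x = x. Proof. by []. Qed.
Lemma bop0E x : (0 : bop H) x = 0. Proof. by []. Qed.

Definition bopE := (bopBE, bopDE, bopNE, bopZE, bopME, bop1E, bop0E).

Lemma rnorm_app T x : rnorm (T x) <= rnorm T * rnorm x.
Proof.
have := le_opnorm T x; rewrite -bop_normE !rnormE -rmorphM /=.
by rewrite lecR.
Qed.

Lemma rnorm_bop T (c : R) : 0 <= c ->
  (forall x, rnorm (T x) <= c * rnorm x) -> rnorm T <= c.
Proof.
move=> c0 Tc; rewrite -lecR -rnormE bop_normE; apply: opnorm_le => [|x].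
  by rewrite lecR.
rewrite !rnormE !lecR => x1; apply: le_trans (Tc x) _.
exact: ler_piMr.
Qed.

Lemma rnorm_comp S T : rnorm (S * T) <= rnorm S * rnorm T.
Proof.
apply: rnorm_bop => [|x]; first by rewrite mulr_ge0 ?rnorm_ge0.
rewrite bopME -mulrA; apply: le_trans (rnorm_app _ _) _.
by rewrite ler_wpM2l ?rnorm_ge0// rnorm_app.
Qed.

Lemma bop_of (f : H -> H) (c : R) : linear f ->
  (forall x, rnorm (f x) <= c * rnorm x) -> exists T : bop H, forall x, T x = f x.
Proof.
move=> lf fc; have fB : f \in @bounded_operator R H.
  by apply/asboolP; split=> //; exists c%:C => x; rewrite !rnormE -rmorphM /= lecR.
by exists (Bop fB).
Qed.

Hypothesis cH : rcomplete H.

(** The pointwise limit is approached uniformly, with error at most [e * rnorm x]; this makes it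
    bounded and the convergence one in operator norm. *)
Lemma bop_rcomplete : rcomplete (bop H).
Proof.
move=> u cu.
have /choice[l lP] x : exists l, rcvg (fun n => u n x) l.
  apply: cH => e e0.
  have d0 : 0 < rnorm x + 1 by rewrite ltr_wpDl ?rnorm_ge0.
  have [N uN] := cu _ (divr_gt0 e0 d0); exists N => m n Nm Nn.
  have := uN _ _ Nm Nn; rewrite -bopBE ltr_pdivlMr//; apply: le_lt_trans.
  by rewrite (le_trans (rnorm_app _ _))// ler_wpM2l ?rnorm_ge0// lerDl.
have ul e : 0 < e -> exists N, forall n, (N <= n)%N ->
    forall x, rnorm (u n x - l x) <= e * rnorm x.
  move=> e0; have [N uN] := cu _ e0; exists N => n Nn x.
  rewrite rdistC; apply: (@rcvg_rnorm_le _ _ (fun k => u k x - u n x)).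
    exact: rcvg_subr.
  exists N => k Nk; rewrite -bopBE; apply: le_trans (rnorm_app _ _) _.
  by rewrite ler_wpM2r ?rnorm_ge0// ltW// uN.
have [N uN] := ul 1 ltr01.
have [|x|T TE] := @bop_of l (rnorm (u N) + 1).
- move=> c x y; apply: (rcvg_unique (lP _)).
  have -> : (fun n => u n (c *: x + y)) = (fun n => c *: u n x + u n y).
    by apply/funext => n; rewrite linearP.
  by apply: rcvgD => //; apply: rcvgZ.
- have := uN _ (leqnn _) x; have := rnorm_app (u N) x.
  have := rdistD (u N x) (l x) 0; rewrite !subr0 [rnorm (l x - _)]rdistC; lra.
exists T => e e0; have e2 : 0 < e / 2 by lra.
have [M uM] := ul _ e2; exists M => n /uM hn.
have: rnorm (u n - T) <= e / 2 by apply: rnorm_bop => [|x]; [lra|rewrite bopBE TE].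
lra.
Qed.

End BopNorm.

(** * Rank one operators and orthogonal projections *)

Section RankOneAndProjections.
Variables (R : realType) (H : completeNormedModType R[i]).
Variables (ip : {dot H for Num.conj}) (ip_norm : forall x : H, ip x x = `|x| ^+ 2).
Implicit Types (x y z : H) (M N : set H) (T : bop H).

Lemma rank_one_exists x y :
  exists T : bop H, forall z, T z = ip z y *: x.
Proof.
apply: (@bop_of _ _ _ (rnorm y * rnorm x)) => [c u v|z].
  by rewrite ipDl ipZl scalerDl scalerA.
rewrite rnormZ mulrAC ler_wpM2r ?rnorm_ge0// mulrC.
exact: cauchy_schwarz.
Qed.

Definition rank_one x y := sval (cid (rank_one_exists x y)).

Lemma rank_oneE x y z : rank_one x y z = ip z y *: x.
Proof. exact: (svalP (cid (rank_one_exists x y))). Qed.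

Lemma rnorm_rank_one x y : rnorm (rank_one x y) <= rnorm x * rnorm y.
Proof.
apply: rnorm_bop => [|z]; first by rewrite mulr_ge0 ?rnorm_ge0.
rewrite rank_oneE rnormZ -mulrA mulrC ler_wpM2l ?rnorm_ge0// mulrC.
exact: cauchy_schwarz.
Qed.

Definition is_proj M T := (forall x, M (T x)) /\ (forall x m, M m -> ip (x - T x) m = 0).

(** The hypotheses on [M] stand under the existential quantifier so that [proj] is defined for every
    set; for other sets the witness given here is 0. *)
Lemma proj_exists M : exists T : bop H,
  linear_subspace M -> closed M -> is_proj M T.
Proof.
have [[sM cM]|nM] := pselect (linear_subspace M /\ closed M); last first.
  by exists 0 => sM cM; case: nM.
have [M0 MD MZ] := sM.
have /choice[f fP] x : exists p, M p /\ forall m, M m -> ip (x - p) m = 0.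
  by have [p] := projection_theorem ip_norm x sM cM; exists p.
have f_uniq x p : M p -> (forall m, M m -> ip (x - p) m = 0) -> f x = p.
  move=> Mp xp; have [Mf xf] := fP x; apply/eqP; rewrite -subr_eq0; apply/eqP.
  have MfB := subspaceB sM Mf Mp.
  apply: (ip_eq0 ip_norm); have := xf _ MfB; have := xp _ MfB.
  rewrite !ipBl => /eqP; rewrite subr_eq0 => /eqP <- /eqP.
  by rewrite subr_eq0 => /eqP ->; rewrite subrr.
have [c x y|x|T TE] := @bop_of _ _ f 1.
- have [Mx ox] := fP x; have [My oy] := fP y.
  apply: f_uniq => [|m Mm]; first by apply: MD => //; exact: MZ.
  by rewrite opprD addrACA -scalerBr ipDl ipZl ox// oy// mulr0 addr0.
- have [Mx ox] := fP x; rewrite mul1r.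
  rewrite -[in leRHS](subrK (f x) x) addrC.
  by apply: (pythagoras_le ip_norm); apply: ip_eq0C; exact: ox.
by exists T => _ _; split=> x; rewrite TE; have [] := fP x.
Qed.

Definition proj M := sval (cid (proj_exists M)).

Lemma projP M : linear_subspace M -> closed M -> is_proj M (proj M).
Proof. exact: (svalP (cid (proj_exists M))). Qed.

Section OneSubspace.
Variable M : set H.
Hypotheses (sM : linear_subspace M) (cM : closed M).

Lemma proj_in x : M (proj M x).
Proof. by have [] := projP sM cM. Qed.

Lemma proj_ortho x m : M m -> ip (x - proj M x) m = 0.
Proof. by have [_ h] := projP sM cM => Mm; exact: h. Qed.

Lemma proj_uniq x p : M p -> (forall m, M m -> ip (x - p) m = 0) -> proj M x = p.
Proof.
move=> Mp xp; apply/eqP; rewrite -subr_eq0; apply/eqP.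
have MB := subspaceB sM (proj_in x) Mp.
apply: (ip_eq0 ip_norm); have := xp _ MB; have := proj_ortho x MB.
rewrite !ipBl => /eqP; rewrite subr_eq0 => /eqP <- /eqP.
by rewrite subr_eq0 => /eqP ->; rewrite subrr.
Qed.

Lemma proj_id x : M x -> proj M x = x.
Proof. by move=> Mx; apply: proj_uniq => // m _; rewrite subrr ip0l. Qed.

Lemma proj_perp x : (forall m, M m -> ip x m = 0) -> proj M x = 0.
Proof.
by move=> xM; apply: proj_uniq => [|m /xM]; [case: sM|rewrite subr0].
Qed.

Lemma proj_sqr x : rnorm x ^+ 2 = rnorm (proj M x) ^+ 2 + rnorm (x - proj M x) ^+ 2.
Proof.
have /(pythagoras ip_norm) : ip (x - proj M x) (proj M x) = 0.
  exact/proj_ortho/proj_in.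
by rewrite subrK addrC.
Qed.

Lemma rnorm_proj_le x : rnorm (proj M x) <= rnorm x.
Proof.
rewrite -(@ler_pXn2r _ 2)// ?nnegrE ?rnorm_ge0// [leRHS]proj_sqr lerDl.
exact: sqr_ge0.
Qed.

Lemma rnorm_coproj_le x : rnorm (x - proj M x) <= rnorm x.
Proof.
rewrite -(@ler_pXn2r _ 2)// ?nnegrE ?rnorm_ge0// [leRHS]proj_sqr lerDr.
exact: sqr_ge0.
Qed.

End OneSubspace.
End RankOneAndProjections.

(** * Total boundedness and compact operators *)

(** Keeping one point for each label of [L] that occurs turns a net with arbitrary centres into one
    whose centres lie in [A]. *)
Lemma finite_representatives (X T : eqType) (A : set X) (c : X -> T) (L : seq T) :
  (forall x, A x -> c x \in L) ->
  exists xs : seq X, (forall x, x \in xs -> A x) /\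
    forall x, A x -> exists2 x', x' \in xs & c x' = c x.
Proof.
elim: L A => [|t L IH] A AL.
  by exists [::]; split=> // x /AL.
have [|xs [xsA xsP]] := IH [set x | A x /\ c x != t].
  by move=> x [/AL]; rewrite inE => /predU1P[->|//]; rewrite eqxx.
have [[x0 [Ax0 cx0]]|nx] := pselect (exists x, A x /\ c x = t).
  exists (x0 :: xs); split=> [x|x Ax].
    by rewrite inE => /predU1P[->|/xsA[]].
  have [ct|ct] := eqVneq (c x) t; first by exists x0; rewrite ?mem_head ?cx0.
  by have [//|x' x'xs cx'] := xsP x; exists x' => //; rewrite inE x'xs orbT.
exists xs; split=> [x /xsA[]//|x Ax].
by apply: xsP; split=> //; apply/eqP => ct; apply: nx; exists x.
Qed.

Section TotallyBounded.
Variables (R : realType).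

Definition totally_bounded (V : normedZmodType R[i]) (A : set V) := forall e : R, 0 < e ->
  exists s : seq V, forall x, A x -> exists2 y, y \in s & rnorm (x - y) < e.

Section Zmod.
Variable V : normedZmodType R[i].
Implicit Types (A B : set V).

Lemma totally_bounded_joint_net (X Y : eqType) (A : set X) (g : X -> Y -> V) (ys : seq Y)
    (e : R) : 0 < e ->
  (forall y, y \in ys -> totally_bounded [set g x y | x in A]) ->
  exists xs : seq X, (forall x, x \in xs -> A x) /\
    forall x, A x -> exists2 x', x' \in xs &
      forall y, y \in ys -> rnorm (g x y - g x' y) < e.
Proof.
move=> e0 gtb; have e2 : 0 < e / 2 by lra.
(* The label of [x] lists, for each [y] in [ys], a centre within [e / 2] of [g x y]. There are
   finitely many labels, and equal labels force all the values within [e] of each other. *)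
suff [c [L [cL cP]]] : exists (c : X -> seq V) (L : seq (seq V)),
    (forall x, A x -> c x \in L) /\
    forall x x', A x -> A x' -> c x' = c x ->
      forall y, y \in ys -> rnorm (g x y - g x' y) < e.
  have [xs [xsA xsP]] := finite_representatives cL.
  exists xs; split=> // x Ax; have [x' x'xs cx'] := xsP _ Ax.
  by exists x' => //; apply: cP => //; exact: xsA.
elim: ys gtb => [|y ys IH] gtb.
  by exists (fun=> [::]), [:: [::]]; split=> // x _; rewrite mem_head.
have [|c [L [cL cP]]] := IH; first by move=> z zys; apply: gtb; rewrite inE zys orbT.
have [s sP] := gtb y (mem_head _ _) _ e2.
have /choice[d dP] x : exists v, A x -> v \in s /\ rnorm (g x y - v) < e / 2.
  have [Ax|nAx] := pselect (A x); last by exists 0.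
  by have [|v vs xv] := sP (g x y); [exists x|exists v].
exists (fun x => d x :: c x), [seq v :: l | v <- s, l <- L]; split=> [x Ax|x x' Ax Ax'].
  by apply/allpairsP; exists (d x, c x); split=> //=; [have [] := dP _ Ax|exact: cL].
case=> dd cc z; rewrite inE => /predU1P[->|zys]; last exact: cP.
have [_] := dP _ Ax; have [_] := dP _ Ax'; rewrite dd.
have := rdistD (d x) (g x y) (g x' y); rewrite [rnorm (d x - _)]rdistC; lra.
Qed.

(** The joint net for a single index; the type [bool] only supplies that index. *)
Lemma totally_bounded_inner_net A (e : R) : 0 < e -> totally_bounded A ->
  exists s : seq V, (forall y, y \in s -> A y) /\
    forall x, A x -> exists2 y, y \in s & rnorm (x - y) < e.
Proof.
move=> e0 Atb.
have [|s [sA sP]] := @totally_bounded_joint_net V bool A (fun x _ => x) [:: true] _ e0.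
  by move=> _ _; rewrite image_id.
exists s; split=> // x /sP[y ys xy]; exists y => //.
by apply: (xy true); rewrite mem_head.
Qed.

Lemma totally_bounded_approx A :
  (forall e : R, 0 < e -> exists2 B, totally_bounded B &
     forall x, A x -> exists2 y, B y & rnorm (x - y) < e) -> totally_bounded A.
Proof.
move=> AB e e0; have e2 : 0 < e / 2 by lra.
have [B Btb BP] := AB _ e2; have [s sP] := Btb _ e2; exists s => x /BP[y /sP[z zs yz] xy].
by exists z => //; have := rdistD y x z; lra.
Qed.

Lemma totally_bounded_subset A B : A `<=` B -> totally_bounded B -> totally_bounded A.
Proof.
move=> AB Btb; apply: totally_bounded_approx => e e0; exists B => // x /AB Bx.
by exists x => //; rewrite subrr rnorm0.
Qed.

Lemma totally_boundedD A B : totally_bounded A -> totally_bounded B ->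
  totally_bounded [set x + y | x in A & y in B].
Proof.
move=> Atb Btb e e0; have e2 : 0 < e / 2 by lra.
have [s sP] := Atb _ e2; have [t tP] := Btb _ e2.
exists [seq x + y | x <- s, y <- t] => _ [x /sP[x' x's xx'] [y /tP[y' y't yy'] <-]].
exists (x' + y'); first by apply/allpairsP; exists (x', y').
rewrite opprD addrACA; have := rnormD (x - x') (y - y'); lra.
Qed.

(** Two terms near the same centre would be too close, so distinct terms use distinct centres of a
    finite net; the pigeonhole principle concludes. *)
Lemma separated_not_totally_bounded A (u : nat -> V) (d : R) : 0 < d ->
  (forall n, A (u n)) -> (forall m n, (m < n)%N -> d <= rnorm (u m - u n)) ->
  ~ totally_bounded A.
Proof.
move=> d0 Au ud Atb; have d2 : 0 < d / 2 by lra.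
have [s sP] := Atb _ d2.
have /choice[c cP] n : exists y, y \in s /\ rnorm (u n - y) < d / 2.
  by have [y ys uy] := sP _ (Au n); exists y.
have cinj : injective c.
  move=> m n cmn; apply/eqP; case: ltngtP => // mn; exfalso; have := ud _ _ mn.
    have := rdistD (c m) (u m) (u n); have [_] := cP m; have [_] := cP n.
    rewrite -cmn [rnorm (c m - _)]rdistC; lra.
  have := rdistD (c m) (u n) (u m); have [_] := cP m; have [_] := cP n.
  rewrite -cmn [rnorm (c m - _)]rdistC; lra.
have : (size [seq c i | i <- iota 0 (size s).+1] <= size s)%N.
  apply: uniq_leq_size; first by rewrite map_inj_uniq ?iota_uniq.
  by move=> _ /mapP[i _ ->]; have [] := cP i.
by rewrite size_map size_iota ltnn.
Qed.

End Zmod.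

Lemma totally_bounded_image (V W : normedZmodType R[i]) (A : set V) (f : V -> W) (c : R) :
  (forall x y, A x -> A y -> rnorm (f x - f y) <= c * rnorm (x - y)) ->
  totally_bounded A -> totally_bounded (f @` A).
Proof.
move=> fc Atb e e0; have d0 : 0 < e / (`|c| + 1) by rewrite divr_gt0// ltr_wpDl.
have [s [sA sP]] := totally_bounded_inner_net d0 Atb.
exists [seq f y | y <- s] => _ [x Ax <-]; have [y ys xy] := sP _ Ax.
exists (f y); first exact: map_f.
apply: le_lt_trans (fc _ _ Ax (sA _ ys)) _.
apply: (@le_lt_trans _ _ ((`|c| + 1) * rnorm (x - y))).
  by rewrite ler_wpM2r ?rnorm_ge0//; have := ler_norm c; lra.
by rewrite mulrC -ltr_pdivlMr// ltr_wpDl.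
Qed.

Section Normed.
Variable V : normedModType R[i].
Implicit Types A : set V.

Lemma precompact_totally_bounded A : precompact A -> totally_bounded A.
Proof.
rewrite precompactE compact_cover => cA e e0.
have [||s _ sP] := cA V setT (fun x => [set y | rnorm (x - y) < e]°).
- by move=> x _; exact: open_interior.
- move=> x _; exists x => //; apply/nbhs_rball; exists e => //.
- exists (finmap.enum_fset s) => x Ax; have [|y ys /interior_subset xy] := sP x.
    exact: subset_closure.
  by exists y => //; rewrite rdistC.
Qed.

(** An ultrafilter on [closure A] contains, for every radius, a ball of a finite net. Balls of
    radius [2^-1 ^+ n] belonging to it meet, so their centres converge geometrically, to a limit of
    the ultrafilter. *)
Lemma totally_bounded_precompact A :
  rcomplete V -> totally_bounded A -> precompact A.
Proof.
move=> cV Atb; rewrite precompactE.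
have cAtb : totally_bounded (closure A).
  apply: totally_bounded_approx => e e0; exists A => // x /closureP/(_ _ e0)[y Ay xy].
  by exists y.
rewrite compact_ultra => F UF FA.
have small (e : R) : 0 < e -> exists y, F [set x | rnorm (x - y) < e].
  move=> e0; have [s sP] := cAtb _ e0.
  have : F [set x | exists2 y, y \in s & rnorm (x - y) < e].
    by apply: filterS FA => x /sP.
  elim: s {sP} => [/filter_ex[x []]//|y s IH] FU.
  have [|Fy] := in_ultra_setVsetC [set x | rnorm (x - y) < e] UF; first by exists y.
  apply: IH; apply: filterS (filterI FU Fy) => x [[z]].
  by rewrite inE => /predU1P[-> //|zs xz] _; exists z.
have p0 n : 0 < 2^-1 ^+ n :> R by rewrite exprn_gt0// invr_gt0.
have /choice[y yP] n := small _ (p0 n).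
have [|l [yl ylr]] := @geom_rcvg _ _ y 2 cV.
  move=> n; have [x [/= xy xy']] := filter_ex (filterI (yP n) (yP n.+1)).
  have := rdistD x (y n.+1) (y n); rewrite [rnorm (y n.+1 - x)]rdistC.
  by move: xy'; rewrite exprS; have := p0 n; lra.
exists l; split; last first.
  move=> B /nbhs_rball[e e0 eB].
  (* A point [x] of the ball is within [2^-1 ^+ N] of [y N], which is within four times that of [l]:
     at most five eighths of [e] in all. *)
  have e8 : 0 < e / 8 by lra.
  have [N /(_ N (leqnn _)) Ne] := half_pow_lt e8.
  apply: filterS (yP N) => x /= xy; apply: eB.
  rewrite rdistC; have := rdistD (y N) x l; have := ylr N; lra.
apply: closed_closure; apply/closureP => e e0.
have e8 : 0 < e / 8 by lra.
have [N /(_ N (leqnn _)) Ne] := half_pow_lt e8.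
have [x [/= xy cAx]] := filter_ex (filterI (yP N) FA).
exists x => //.
by rewrite rdistC; have := rdistD (y N) x l; have := ylr N; lra.
Qed.

Lemma totally_boundedE A : rcomplete V -> precompact A <-> totally_bounded A.
Proof.
move=> cV; split; first exact: precompact_totally_bounded.
exact: totally_bounded_precompact.
Qed.

End Normed.
End TotallyBounded.

(** * Compact operators and their permanence properties *)

Section CompactOperators.
Variables (R : realType) (H : normedModType R[i]).
Hypothesis cH : rcomplete H.
Implicit Types (S T K : bop H).

Definition unit_ball (V : normedZmodType R[i]) := [set x : V | rnorm x <= 1].
Definition compact_op T := totally_bounded (T @` @unit_ball H).

Lemma normr_le1 (V : normedZmodType R[i]) (x : V) : (`|x| <= 1) = (rnorm x <= 1).
Proof. by rewrite rnormE lecR. Qed.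

Lemma compact_opP T : compact_map_on [set: H] T <-> compact_op T.
Proof.
rewrite /compact_map_on totally_boundedE// /compact_op.
suff -> : [set x : H | [set: H] x /\ `|x| <= 1] = @unit_ball H by [].
by apply/seteqP; split=> x /=; rewrite /unit_ball/= normr_le1; [case|].
Qed.

Lemma compact_map_onP (A : set (bop H)) (f : bop H -> bop H) :
  compact_map_on A f <-> totally_bounded [set f x | x in A `&` @unit_ball (bop H)].
Proof.
rewrite /compact_map_on totally_boundedE; last exact: bop_rcomplete.
suff -> : [set x : bop H | A x /\ `|x| <= 1] = A `&` @unit_ball (bop H) by [].
by apply/seteqP; split=> x /=; rewrite /unit_ball/= normr_le1.
Qed.

Lemma rnorm_bop_ball T (c : R) : 0 <= c ->
  (forall x, rnorm x <= 1 -> rnorm (T x) <= c) -> rnorm T <= c.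
Proof.
move=> c0 Tc; rewrite -lecR -rnormE bop_normE; apply: opnorm_le => [|x].
  by rewrite lecR.
by rewrite normr_le1 rnormE lecR => /Tc.
Qed.

Lemma compact_op0 : compact_op 0.
Proof. by move=> e e0; exists [:: 0] => _ [x _ <-]; exists 0; rewrite ?mem_head// bop0E subrr rnorm0. Qed.

Lemma compact_opD S T : compact_op S -> compact_op T -> compact_op (S + T).
Proof.
move=> cS cT; apply: totally_bounded_subset (totally_boundedD cS cT).
by move=> _ [x x1 <-]; exists (S x); [exists x|exists (T x); [exists x|]].
Qed.

Lemma compact_op_compl S T : compact_op T -> compact_op (S * T).
Proof.
move=> cT; apply: totally_bounded_subset (totally_bounded_image (f := S) (c := rnorm S) _ cT).
  by move=> _ [x x1 <-]; exists (T x) => //; exists x.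
by move=> x y _ _; rewrite -linearB rnorm_app.
Qed.

Lemma compact_opZ c T : compact_op T -> compact_op (c *: T).
Proof.
move=> cT; have -> : c *: T = ((c *: (1 : bop H)) : bop H) * T by apply: bopP.
exact: compact_op_compl.
Qed.

Lemma compact_opB S T : compact_op S -> compact_op T -> compact_op (S - T).
Proof.
move=> cS cT; apply: compact_opD => //.
by rewrite -scaleN1r; exact: compact_opZ.
Qed.

Lemma compact_op_bounded T (r : R) :
  compact_op T -> totally_bounded (T @` [set x | rnorm x <= r]).
Proof.
move=> cT; have /(@totally_bounded_subset _ _ _ _) := compact_opZ (`|r| + 1)%:C cT.
apply=> _ [x /= xr <-]; have r1 : 0 < `|r| + 1 by rewrite ltr_wpDl.
exists ((`|r| + 1)^-1%:C *: x).
  rewrite /unit_ball /= rnormZ rnorm_real ger0_norm; last by rewrite invr_ge0 ltW.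
  by rewrite ler_pdivrMl// mulr1; have := ler_norm r; lra.
transitivity ((`|r| + 1)%:C *: T ((`|r| + 1)^-1%:C *: x)); first by [].
by rewrite linearZ scalerA -rmorphM mulfV ?scale1r// gt_eqF.
Qed.

Lemma compact_op_compr S T : compact_op T -> compact_op (T * S).
Proof.
move=> /(@compact_op_bounded _ (rnorm S)); apply: totally_bounded_subset.
move=> _ [x x1 <-]; exists (S x) => //=; apply: le_trans (rnorm_app _ _) _.
by rewrite ler_piMr ?rnorm_ge0.
Qed.

Lemma compact_op_limit T :
  (forall e : R, 0 < e -> exists2 K, compact_op K & rnorm (T - K) < e) -> compact_op T.
Proof.
move=> TK; apply: totally_bounded_approx => e /TK[K cK TKe].
exists (K @` @unit_ball H) => // _ [x x1 <-]; exists (K x); first by exists x.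
rewrite -bopBE; apply: le_lt_trans TKe; apply: le_trans (rnorm_app _ _) _.
by rewrite ler_piMr ?rnorm_ge0.
Qed.

(** Finitely many [y] approximate the image of the unit ball under [K]; for each of them [K (x y)]
    ranges over a totally bounded set as [x] varies, and a joint net for these [y] is a net for the
    operators [K * x * K]. *)
Lemma compact_op_two_sided K : compact_op K ->
  totally_bounded [set K * x * K | x in @unit_ball (bop H)].
Proof.
move=> cK e e0.
have k0 : 0 < rnorm K + 1 by rewrite ltr_wpDl ?rnorm_ge0.
(* As [K * (x - x')] has norm at most [2 * (rnorm K + 1)], replacing [K v] by [y] within this radius
   costs at most [e / 2]; the joint net adds [e / 4]. *)
have d0 : 0 < e / (4 * (rnorm K + 1)) by rewrite divr_gt0// mulr_gt0.
have [ys ysP] := cK _ d0; have e4 : 0 < e / 4 by lra.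
have [y yys|xs [xs1 xsP]] := @totally_bounded_joint_net _ _ _ _
    (@unit_ball (bop H)) (fun x y => K (x y)) ys _ e4.
  apply: totally_bounded_subset (@compact_op_bounded _ (rnorm y) cK).
  move=> _ [x x1 <-]; exists (x y) => //=; apply: le_trans (rnorm_app _ _) _.
  by rewrite ler_piMl ?rnorm_ge0.
exists [seq K * x * K | x <- xs] => _ [x x1 <-].
have [x' x'xs xx'] := xsP _ x1; exists (K * x' * K); first by apply/mapP; exists x'.
suff : rnorm (K * x * K - K * x' * K) <= 3 * (e / 4) by lra.
apply: rnorm_bop_ball => [|v v1]; first by lra.
have [|y yys vy] := ysP (K v); first by exists v.
have -> : (K * x * K - K * x' * K) v =
    (K * (x - x')) (K v - y) + (K (x y) - K (x' y)).
  rewrite !bopE -[K (x y) - _]linearB -[LHS]linearB -[RHS]linearD; congr (K _).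
  by rewrite !linearB /= [X in _ = X + _]addrACA -opprD subrK.
apply: le_trans (rnormD _ _) _; have := xx' _ yys.
have : rnorm ((K * (x - x')) (K v - y)) <= 2 * (e / 4); last lra.
apply: le_trans (rnorm_app _ _) _.
apply: (@le_trans _ _ (((rnorm K + 1) * 2) * (e / (4 * (rnorm K + 1))))).
  apply: ler_pM; [exact: rnorm_ge0|exact: rnorm_ge0| |exact: ltW].
  apply: le_trans (rnorm_comp _ _) _; apply: ler_pM; rewrite ?rnorm_ge0 ?lerDl//.
  have := rnormB x x'; have := xs1 _ x'xs; move: x1; rewrite /unit_ball/=; lra.
have -> // : (rnorm K + 1) * 2 * (e / (4 * (rnorm K + 1))) = 2 * (e / 4).
by field; rewrite gt_eqF.
Qed.

End CompactOperators.

(** * Interval projections of a nest *)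

Section NestProjections.
Variables (R : realType) (H : completeNormedModType R[i]).
Variables (ip : {dot H for Num.conj}) (ip_norm : forall x : H, ip x x = `|x| ^+ 2).
Variables (Ns : set (set H)) (Ns_nest : nest Ns).
Implicit Types (x y z : H) (M N L : set H) (S T X : bop H).

Local Notation A := (nest_alg Ns).

Lemma closed_span_sub (F M : set H) : linear_subspace M -> closed M -> F `<=` M ->
  closed_span F `<=` M.
Proof.
move=> sM cM FM; rewrite /closed_span [X in _ `<=` X](closure_id _).1//.
by apply: closureS; apply: smallest_sub.
Qed.

Lemma sub_closed_span (F : set H) : F `<=` closed_span F.
Proof. by apply: subset_trans (@subset_closure _ _); exact: sub_smallest. Qed.

Lemma nest_algP T : A T <-> forall N x, Ns N -> N x -> N (T x).
Proof.
split=> [AT N x NN Nx|AT N NN _ [x Nx <-]]; last exact: AT.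
by apply: (AT N NN); exists x.
Qed.

Definition nproj N := proj ip_norm N.
Local Notation P := nproj.
Definition nint M N : bop H := P N - P M.
Local Notation E := nint.

Section OneProjection.
Variable N : set H.
Hypothesis NN : Ns N.
Let sN := nest_subspace Ns_nest NN.
Let cN := nest_closed Ns_nest NN.

Lemma nproj_in x : N (P N x). Proof. exact: proj_in. Qed.
Lemma nproj_id x : N x -> P N x = x. Proof. exact: proj_id. Qed.
Lemma nproj_perp x : (forall m, N m -> ip x m = 0) -> P N x = 0.
Proof. exact: proj_perp. Qed.
Lemma nproj_ortho x m : N m -> ip (x - P N x) m = 0.
Proof. exact: proj_ortho. Qed.
Lemma rnorm_nproj x : rnorm (P N x) <= rnorm x. Proof. exact: rnorm_proj_le. Qed.
Lemma rnorm_conproj x : rnorm (x - P N x) <= rnorm x. Proof. exact: rnorm_coproj_le. Qed.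
Lemma nproj_sqr x : rnorm x ^+ 2 = rnorm (P N x) ^+ 2 + rnorm (x - P N x) ^+ 2.
Proof. exact: proj_sqr. Qed.

Lemma nproj_alg_comp T : A T -> P N * T * P N = T * P N.
Proof.
by move=> /nest_algP AT; apply: bopP => x; rewrite !bopE nproj_id//; apply: AT => //; exact: nproj_in.
Qed.

End OneProjection.

Lemma nproj0 : P [set 0] = 0.
Proof. by apply: bopP => x; have := nproj_in (nest0 Ns_nest) x; rewrite bop0E. Qed.

Lemma nprojT : P [set: H] = 1.
Proof. by apply: bopP => x; apply: nproj_id => //; exact: nestT. Qed.

Lemma nproj_mull M N : Ns M -> Ns N -> M `<=` N -> P N * P M = P M.
Proof.
move=> NM NN MN; apply: bopP => x; rewrite bopE nproj_id//.
by apply: MN; exact: nproj_in.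
Qed.

Lemma nproj_mulr M N : Ns M -> Ns N -> M `<=` N -> P M * P N = P M.
Proof.
move=> NM NN MN; apply: bopP => x; rewrite bopE.
rewrite -[in RHS](subrK (P N x) x) linearD [X in _ = X + _]nproj_perp ?add0r//.
by move=> m Mm; rewrite nproj_ortho//; exact: MN.
Qed.

Lemma alg0 : A 0.
Proof.
by apply/nest_algP => N x NN _; have [] := nest_subspace Ns_nest NN.
Qed.

Lemma alg1 : A 1. Proof. by apply/nest_algP. Qed.

Lemma algD S T : A S -> A T -> A (S + T).
Proof.
move=> /nest_algP AS /nest_algP AT; apply/nest_algP => N x NN Nx.
by have [_ ND _] := nest_subspace Ns_nest NN; apply: ND; [exact: AS|exact: AT].
Qed.

Lemma algZ c T : A T -> A (c *: T).
Proof.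
move=> /nest_algP AT; apply/nest_algP => N x NN Nx.
by have [_ _ NZ] := nest_subspace Ns_nest NN; apply: NZ; exact: AT.
Qed.

Lemma algN T : A T -> A (- T).
Proof. by rewrite -scaleN1r; exact: algZ. Qed.

Lemma algB S T : A S -> A T -> A (S - T).
Proof. by move=> AS AT; apply: algD => //; exact: algN. Qed.

Lemma algM S T : A S -> A T -> A (S * T).
Proof.
move=> /nest_algP AS /nest_algP AT; apply/nest_algP => N x NN Nx.
by rewrite bopE; apply: (AS) => //; exact: AT.
Qed.

Lemma alg_subspace : linear_subspace A.
Proof. by split; [exact: alg0|exact: algD|exact: algZ]. Qed.

Lemma alg_nproj N : Ns N -> A (P N).
Proof.
move=> NN; apply/nest_algP => M x NM Mx.
have [MN|NM'] := nest_total Ns_nest NM NN.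
  by rewrite nproj_id//; exact: MN.
by apply: NM'; exact: nproj_in.
Qed.

Lemma alg_nint M N : Ns M -> Ns N -> A (E M N).
Proof. by move=> NM NN; apply: algB; exact: alg_nproj. Qed.

(** A member [L] above [N] contains the range, and one below [M] is annihilated. Both block
    sequences, with [M = N], and gaps are instances. *)
Lemma alg_rank_one M N x y : Ns M -> Ns N -> (forall L, Ns L -> N `<=` L \/ L `<=` M) ->
  N x -> (forall m, M m -> ip m y = 0) -> A (rank_one ip_norm x y).
Proof.
move=> NM NN MNgap Nx My; apply/nest_algP => L z NL Lz; rewrite rank_oneE.
have [L0 _ LZ] := nest_subspace Ns_nest NL.
have [/(_ x Nx)|/(_ z Lz)/My ->] := MNgap _ NL; first exact: LZ.
by rewrite scale0r.
Qed.

(** * Compressions to intervals of the nest *)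

Section Intervals.
Variables (M N : set H).
Hypotheses (NM : Ns M) (NN : Ns N) (MN : M `<=` N).

Lemma nint_sub M' N' : Ns M' -> Ns N' -> M `<=` M' -> M' `<=` N' -> N' `<=` N ->
  E M' N' * E M N = E M' N' /\ E M N * E M' N' = E M' N'.
Proof.
move=> NM' NN' MM' MN' NN1; have MN'' := subset_trans MM' MN'.
have M'N := subset_trans MN' NN1.
rewrite /nint !mulrBl !mulrBr.
rewrite (nproj_mulr NN' NN)// (nproj_mull NM NN')// (nproj_mulr NM' NN)//.
rewrite (nproj_mull NM NM')// (nproj_mull NN' NN)// (nproj_mulr NM NN')//.
rewrite (nproj_mull NM' NN)// (nproj_mulr NM NM')//.
by split; [rewrite opprB subrKA|rewrite subrr subr0].
Qed.

Lemma nint_idem : E M N * E M N = E M N.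
Proof. by have [] := nint_sub NM NN (subset_refl _) MN (subset_refl _). Qed.

Lemma nint_projr : E M N * P N = E M N.
Proof. by rewrite /nint mulrBl nproj_mulr// nproj_mulr. Qed.

Lemma nint_projl : P N * E M N = E M N.
Proof. by rewrite /nint mulrBr nproj_mull// nproj_mull. Qed.

Lemma nint_proj0r : E M N * P M = 0.
Proof. by rewrite /nint mulrBl !nproj_mull// subrr. Qed.

Lemma nint_proj0l : P M * E M N = 0.
Proof. by rewrite /nint mulrBr !nproj_mulr// subrr. Qed.

Lemma nint_app x : E M N x = P N x - P M (P N x).
Proof. by rewrite -(bopME (P M)) nproj_mulr. Qed.

Lemma rnorm_nint_app x : rnorm (E M N x) <= rnorm x.
Proof.
rewrite nint_app; apply: le_trans (rnorm_conproj NM _) _; exact: rnorm_nproj.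
Qed.

Lemma nproj_nint_sqr x :
  rnorm (P N x) ^+ 2 = rnorm (P M x) ^+ 2 + rnorm (E M N x) ^+ 2.
Proof.
by rewrite (nproj_sqr NM (P N x)) nint_app -!(bopME (P M)) nproj_mulr.
Qed.

Lemma rnorm_nint_comp T : rnorm (E M N * T) <= rnorm T.
Proof.
apply: rnorm_bop => [|x]; first exact: rnorm_ge0.
exact: le_trans (rnorm_nint_app _) (rnorm_app _ _).
Qed.

Lemma rnorm_comp_nint T : rnorm (T * E M N) <= rnorm T.
Proof.
apply: rnorm_bop => [|x]; first exact: rnorm_ge0.
rewrite bopE; apply: le_trans (rnorm_app _ _) _.
by rewrite ler_wpM2l ?rnorm_ge0// rnorm_nint_app.
Qed.

Definition compr M N T := E M N * T * E M N.

Lemma rnorm_compr T : rnorm (compr M N T) <= rnorm T.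
Proof. exact: le_trans (rnorm_comp_nint _) (rnorm_nint_comp _). Qed.

Lemma alg_compr T : A T -> A (compr M N T).
Proof. by move=> AT; do 2?apply: algM => //; exact: alg_nint. Qed.

(** Intervals of the nest are semi-invariant: [T * E M N] has range in [N], where
    [P N = E M N + P M], and the contribution of [P M] dies because [S] maps [M] into itself. *)
Lemma comprM S T : A S -> A T -> compr M N (S * T) = compr M N S * compr M N T.
Proof.
move=> AS AT; rewrite /compr.
have TE : T * E M N = P N * (T * E M N).
  by rewrite -{1}nint_projl mulrA -(nproj_alg_comp NN AT) -!mulrA nint_projl.
have EM : E M N * S * P M = 0.
  by rewrite -mulrA -nproj_alg_comp// !mulrA nint_proj0r !mul0r.
have EE X : E M N * (E M N * X) = E M N * X by rewrite mulrA nint_idem.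
rewrite -!mulrA EE [in LHS]TE.
have -> : P N = E M N + P M by rewrite /nint subrK.
rewrite (mulrDl (E M N) (P M)) (mulrDr S) (mulrDr (E M N)).
by rewrite [X in _ + X](_ : _ = 0) ?addr0// !mulrA EM !mul0r.
Qed.

End Intervals.

Lemma comprD M N S T : compr M N (S + T) = compr M N S + compr M N T.
Proof. by rewrite /compr (mulrDr (E M N)) (mulrDl (E M N * S)). Qed.

Lemma comprB M N S T : compr M N (S - T) = compr M N S - compr M N T.
Proof. by rewrite /compr (mulrBr (E M N)) (mulrBl _ (E M N * S)). Qed.

Lemma compr0 M N : compr M N 0 = 0.
Proof. by rewrite /compr mulr0 mul0r. Qed.

Lemma compr_sub M N M' N' T : Ns M -> Ns N -> Ns M' -> Ns N' ->
  M `<=` M' -> M' `<=` N' -> N' `<=` N ->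
  compr M' N' T = compr M' N' (compr M N T).
Proof.
move=> NM NN NM' NN' MM' MN' NN1.
have [e1 e2] := nint_sub NM NN NM' NN' MM' MN' NN1.
by rewrite /compr !mulrA e1 -!mulrA e2.
Qed.

(** * Local properties of intervals and finite partitions of the nest *)

Definition hereditary (Q : set H -> set H -> Prop) := forall M N M' N',
  Ns M -> Ns N -> Ns M' -> Ns N' -> M `<=` M' -> M' `<=` N' -> N' `<=` N ->
  Q M N -> Q M' N'.

Definition nest_locally (Q : set H -> set H -> Prop) :=
  (forall N, Ns N -> N <> [set 0] -> exists M, [/\ Ns M, M `<=` N, M <> N & Q M N]) /\
  (forall N, Ns N -> N <> [set: H] -> exists M, [/\ Ns M, N `<=` M, M <> N & Q N M]).

(** A finite partition of the nest below [L] whose cells satisfy [Q]. The inductive form lets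
    operators be built and inverted by adding one cell at the top; degenerate cells are allowed. *)
Inductive nest_chain (Q : set H -> set H -> Prop) : set H -> Prop :=
| NestChain0 : nest_chain Q [set 0]
| NestChainS N L : nest_chain Q N -> Ns L -> N `<=` L -> Q N L -> nest_chain Q L.

Lemma nest_chain_in Q N : nest_chain Q N -> Ns N.
Proof. by case=> // ; exact: nest0. Qed.

Lemma nest_chain_mono (Q Q' : set H -> set H -> Prop) L :
  (forall M N, Ns M -> Ns N -> M `<=` N -> N `<=` L -> Q M N -> Q' M N) ->
  nest_chain Q L -> nest_chain Q' L.
Proof.
move=> QQ' cL; elim: cL QQ' => [|N L' cN IH NL NL' QNL] QQ'; first exact: NestChain0.
apply: (NestChainS (N := N)) => //; last first.
  by apply: QQ' => //; exact: nest_chain_in cN.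
by apply: IH => M N' NM NN' MN' N'N; apply: QQ' => //; exact: subset_trans NL'.
Qed.

Lemma nest0_sub N : Ns N -> [set 0] `<=` N.
Proof. by move=> NN _ ->; have [] := nest_subspace Ns_nest NN. Qed.

Lemma nest_nsub M N : Ns M -> Ns N -> ~ M `<=` N -> N `<=` M.
Proof. by move=> NM NN MN; have [] := nest_total Ns_nest NM NN. Qed.

(** A compactness argument by suprema: the left condition at the supremum [N0] of the members
    reached by chains shows that [N0] is itself reached, and the right condition would lead beyond
    it unless [N0] is the whole space. *)
Lemma nest_locally_chain Q : hereditary Q -> nest_locally Q -> nest_chain Q [set: H].
Proof.
move=> hQ [QL QR]; set F := [set N | nest_chain Q N].
set N0 := closed_span (\bigcup_(N in F) N).
have NN0 : Ns N0 by apply: nest_closed_span => // N; exact: nest_chain_in.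
have FN0 N : nest_chain Q N -> N `<=` N0.
  by move=> FN; apply: subset_trans (@sub_closed_span _) => x Nx; exists N.
have FN : nest_chain Q N0.
  have [->|N00] := pselect (N0 = [set 0]); first exact: NestChain0.
  have [M [NM MN0 MnN0 QM]] := QL _ NN0 N00.
  have [[N [cN NnM]]|nN] := pselect (exists N, nest_chain Q N /\ ~ N `<=` M).
    have NN := nest_chain_in cN; have MN := nest_nsub NN NM NnM.
    apply: (NestChainS cN) => //; first exact: FN0.
    by apply: (hQ M N0) => //; exact: FN0.
  (* If every member reached lay inside [M], so would the closed span [N0]. *)
  case: MnN0; apply/seteqP; split=> //.
  apply: closed_span_sub; [exact: nest_subspace NM|exact: nest_closed NM|].
  move=> x [N cN Nx]; apply: contrapT => nMx; apply: nN; exists N; split=> // NM'.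
  exact/nMx/NM'.
have [<-//|N0T] := pselect (N0 = [set: H]).
have [M [NM N0M MnN0 QM]] := QR _ NN0 N0T.
by case: MnN0; apply/seteqP; split=> //; apply: FN0; exact: (NestChainS FN).
Qed.

(** On either side of a point there is a cell adjacent to it or containing it; heredity passes from
    the cell to its part on that side. *)
Lemma nest_chain_locally Q : hereditary Q -> nest_chain Q [set: H] -> nest_locally Q.
Proof.
move=> hQ cQ; split.
- suff h L : nest_chain Q L -> forall N, Ns N -> N `<=` L -> N <> [set 0] ->
    exists M, [/\ Ns M, M `<=` N, M <> N & Q M N].
    by move=> N NN; exact: (h _ cQ).
  elim=> [|N' L' cN' IH NL' N'L' QN'] N NN NL N0.
    by case: N0; apply/seteqP; split=> //; exact: nest0_sub.
  have NN' := nest_chain_in cN'.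
  have [|/(nest_nsub NN NN') N'N] := pselect (N `<=` N'); first by move=> ?; exact: IH.
  have [NN'E|NN'E] := pselect (N = N').
    by apply: IH => //; rewrite NN'E.
  exists N'; split=> //; first by move=> e; exact/NN'E/esym.
  exact: (hQ N' L').
- suff h L : nest_chain Q L -> forall N, Ns N -> N `<=` L -> N <> L ->
    exists M, [/\ Ns M, N `<=` M, M <> N & Q N M].
    by move=> N NN; exact: (h _ cQ).
  elim=> [|N' L' cN' IH NL' N'L' QN'] N NN NL N0.
    by case: N0; apply/seteqP; split=> //; exact: nest0_sub.
  have NN' := nest_chain_in cN'.
  have [[NN'1 NN'2]|nNN'] := pselect (N `<=` N' /\ N <> N'); first exact: IH.
  exists L'; split=> //; first by move=> e; exact/N0/esym.
  apply: (hQ N' L') => //.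
  have [//|NN'1] := nest_total Ns_nest NN' NN.
  have [->//|NE] := pselect (N = N'); by case: nNN'.
Qed.

Lemma nest_locallyI Q1 Q2 : hereditary Q1 -> hereditary Q2 ->
  nest_locally Q1 -> nest_locally Q2 -> nest_locally (fun M N => Q1 M N /\ Q2 M N).
Proof.
move=> h1 h2 [L1 R1] [L2 R2]; split=> N NN N0.
- have [M1 [NM1 MN1 Mn1 Q1M]] := L1 _ NN N0; have [M2 [NM2 MN2 Mn2 Q2M]] := L2 _ NN N0.
  have [M12|M21] := nest_total Ns_nest NM1 NM2.
    by exists M2; split=> //; split=> //; apply: h1 Q1M.
  by exists M1; split=> //; split=> //; apply: h2 Q2M.
- have [M1 [NM1 MN1 Mn1 Q1M]] := R1 _ NN N0; have [M2 [NM2 MN2 Mn2 Q2M]] := R2 _ NN N0.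
  have [M12|M21] := nest_total Ns_nest NM1 NM2.
    by exists M1; split=> //; split=> //; apply: h2 Q2M.
  by exists M2; split=> //; split=> //; apply: h1 Q1M.
Qed.

Lemma nest_locally_mono (Q Q' : set H -> set H -> Prop) :
  (forall M N, Ns M -> Ns N -> M `<=` N -> Q M N -> Q' M N) ->
  nest_locally Q -> nest_locally Q'.
Proof.
move=> QQ' [QL QR]; split=> N NN N0.
  by have [M [NM MN MnN QM]] := QL _ NN N0; exists M; split=> //; exact: QQ'.
by have [M [NM MN MnN QM]] := QR _ NN N0; exists M; split=> //; exact: QQ'.
Qed.

Definition small (T : bop H) (e : R) M N := rnorm (compr M N T) <= e.

Lemma small_hereditary T e : hereditary (small T e).
Proof.
move=> M N M' N' NM NN NM' NN' MM' MN' NN1; rewrite /small => Te.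
by rewrite (compr_sub _ NM NN NM' NN')//; apply: le_trans Te; exact: rnorm_compr.
Qed.

End NestProjections.

(** * Block sequences *)

Section BoundedSums.
Variable R : realType.

Lemma bounded_sum_cauchy (a : nat -> R) (K : R) : (forall n, 0 <= a n) ->
  (forall n, \sum_(0 <= j < n) a j <= K) ->
  forall e : R, 0 < e -> exists N, forall m n, (N <= m)%N -> (m <= n)%N ->
    \sum_(m <= j < n) a j < e.
Proof.
move=> a0 aK e e0; set S := range (fun n => \sum_(0 <= j < n) a j).
have supS : has_sup S.
  split; first by exists (\sum_(0 <= j < 0) a j), 0%N.
  by exists K => _ [n _ <-]; exact: aK.
have [_ [N _ <-] SN] := sup_adherent e0 supS.
exists N => m n Nm mn.
have : \sum_(0 <= j < n) a j <= sup S by apply: ub_le_sup; [case: supS|exists n].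
have : \sum_(0 <= j < N) a j <= \sum_(0 <= j < m) a j.
  by rewrite (big_cat_nat (n := N) (p := m))//= lerDl sumr_ge0.
rewrite (big_cat_nat (n := m) (p := n))//=; move: SN; lra.
Qed.

Lemma geometric_sum_le (c : R) n : 0 <= c ->
  \sum_(0 <= k < n) c * 2^-1 ^+ k <= 2 * c.
Proof.
move=> c0; suff : \sum_(0 <= k < n) c * 2^-1 ^+ k <= 2 * c - 2 * c * 2^-1 ^+ n.
  have : 0 <= c * 2^-1 ^+ n by rewrite mulr_ge0// exprn_ge0//; lra.
  lra.
elim: n => [|n IH]; first by rewrite big_nil expr0; lra.
by rewrite big_nat_recr//= exprS; lra.
Qed.

Lemma small_subsequence (b : nat -> nat -> R) (eta : nat -> R) :
  (forall n, 0 < eta n) ->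
  (forall i e, 0 < e -> exists N, forall j, (N <= j)%N -> b i j < e) ->
  exists phi : nat -> nat, (forall i j, (i < j)%N -> (phi i < phi j)%N) /\
    forall i j, (i < j)%N -> b (phi i) (phi j) < eta j.
Proof.
move=> eta0 b0.
have /choice[N NP] (p : nat * nat) : exists N, forall j, (N <= j)%N -> b p.1 j < eta p.2.
  exact: b0.
(* The new index passes the thresholds of all indices up to the previous one, chosen or not, for the
   tolerance of its own position. Adding [(phi j').+1] makes [phi] strictly increasing. *)
pose phi := fix phi j := if j is j'.+1
  then ((phi j').+1 + \max_(i < (phi j').+1) N (nat_of_ord i, j))%N else 0%N.
have phiS j : phi j.+1 = ((phi j).+1 + \max_(i < (phi j).+1) N (nat_of_ord i, j.+1))%N by [].
have phi_lt : forall i j, (i < j)%N -> (phi i < phi j)%N.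
  have step j : (phi j < phi j.+1)%N by rewrite phiS leq_addr.
  move=> i j; elim: j => // j IH; rewrite ltnS leq_eqVlt => /predU1P[->//|/IH h].
  exact: ltn_trans (step j).
exists phi; split=> // i [//|j] ij; apply: (NP (phi i, j.+1)).
have pij : (phi i < (phi j).+1)%N.
  by rewrite ltnS; move: ij; rewrite ltnS leq_eqVlt => /predU1P[->//|/phi_lt/ltnW].
rewrite phiS; apply: leq_trans (leq_addl _ _).
exact: (leq_bigmax (F := fun i : 'I_(phi j).+1 => N (nat_of_ord i, j.+1)) (Ordinal pij)).
Qed.

End BoundedSums.

(** * Orthogonal sequences and the Bessel inequality *)

Section Orthogonal.
Variables (R : realType) (H : completeNormedModType R[i]).
Variables (ip : {dot H for Num.conj}) (ip_norm : forall x : H, ip x x = `|x| ^+ 2).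
Implicit Types (x z e : nat -> H) (c : nat -> R[i]).

Definition orthogonal_seq e := forall j k, j != k -> ip (e j) (e k) = 0.

Lemma sqr_rnorm_orthogonal_sum e c m n : orthogonal_seq e ->
  rnorm (\sum_(m <= j < n) c j *: e j) ^+ 2 =
  \sum_(m <= j < n) rnorm (c j) ^+ 2 * rnorm (e j) ^+ 2.
Proof.
move=> oe; have [mn|nm] := leqP m n; last first.
  by rewrite !big_geq 1?ltnW// rnorm0 expr0n.
elim: n mn => [|n IH].
  by rewrite leqn0 => /eqP ->; rewrite !big_nil rnorm0 expr0n.
rewrite leq_eqVlt => /predU1P[->|mn]; first by rewrite !big_geq// rnorm0 expr0n.
rewrite !big_nat_recr//= -IH// (pythagoras ip_norm) ?rnormZ ?exprMn//.
rewrite ip_suml big_nat_cond big1// => j /andP[/andP[_ jn] _].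
by rewrite ipZl ipZr oe ?mulr0// ltn_eqF.
Qed.

(** Stated for a bounded linear functional, which avoids adjoints. On the vector [v] with
    coefficients conjugate to the [f (e j)], the functional takes the value [s], while
    [rnorm v ^+ 2 <= B ^+ 2 * s]; hence [s ^+ 2 <= (K * B) ^+ 2 * s]. *)
Lemma bessel (f : H -> R[i]) (K B : R) e : 0 <= K -> 0 <= B ->
  (forall a u v, f (a *: u + v) = a * f u + f v) -> (forall v, rnorm (f v) <= K * rnorm v) ->
  orthogonal_seq e -> (forall k, rnorm (e k) <= B) ->
  forall n, \sum_(0 <= j < n) rnorm (f (e j)) ^+ 2 <= (K * B) ^+ 2.
Proof.
move=> K0 B0 lf fK oe eB n; set s := \sum_(_ <= _ < _) _.
have f0 : f 0 = 0.
  by have := lf (-1) 0 0; rewrite scaler0 add0r mulN1r addNr.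
set v := \sum_(0 <= j < n) ((f (e j))^*)%C *: e j.
have s0 : 0 <= s by apply: sumr_ge0 => *; exact: sqr_ge0.
have fv : f v = s%:C.
  rewrite /v /s; elim: n {s v s0} => [|n IH]; first by rewrite !big_nil f0.
  rewrite !big_nat_recr//= addrC lf IH addrC rmorphD /=; congr (_ + _).
  by rewrite mulrC -sqr_normc rnormE rmorphXn.
have nv : rnorm v ^+ 2 <= B ^+ 2 * s.
  rewrite /v sqr_rnorm_orthogonal_sum// /s mulr_sumr; apply: ler_sum => j _.
  by rewrite rnorm_conj mulrC ler_wpM2r ?sqr_ge0// ler_pXn2r ?nnegrE ?rnorm_ge0.
have : s ^+ 2 <= (K * B) ^+ 2 * s.
  have := fK v; rewrite fv rnorm_real ger0_norm// => sv.
  have : s ^+ 2 <= (K * rnorm v) ^+ 2.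
    by rewrite ler_pXn2r// nnegrE mulr_ge0// rnorm_ge0.
  move=> /le_trans; apply; rewrite !exprMn -[leRHS]mulrA ler_wpM2l ?sqr_ge0//.
have [->|sn0] := eqVneq s 0; first by rewrite sqr_ge0.
by rewrite expr2 ler_pM2r// lt_def sn0.
Qed.

Lemma bessel_vanish (f : H -> R[i]) (K B : R) e : 0 <= K -> 0 <= B ->
  (forall a u v, f (a *: u + v) = a * f u + f v) -> (forall v, rnorm (f v) <= K * rnorm v) ->
  orthogonal_seq e -> (forall k, rnorm (e k) <= B) ->
  forall d : R, 0 < d -> exists N, forall j, (N <= j)%N -> rnorm (f (e j)) < d.
Proof.
move=> K0 B0 lf fK oe eB d d0.
have d2 : 0 < d ^+ 2 by rewrite exprn_gt0.
have [N NP] := bounded_sum_cauchy (fun n => sqr_ge0 _) (bessel K0 B0 lf fK oe eB) d2.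
exists N => j Nj; have := NP j j.+1 Nj (leqnSn _).
by rewrite big_nat1 ltr_pXn2r// nnegrE ?rnorm_ge0 ?ltW.
Qed.

(** The operator [sum_k x_k (x) z_k], the series converging strongly. *)
Lemma rank_one_series x z (C : R) : 0 <= C ->
  orthogonal_seq x -> (forall k, rnorm (x k) = 1) ->
  orthogonal_seq z -> (forall k, rnorm (z k) <= C) ->
  exists S : bop H, forall v,
    rcvg (fun n => (\sum_(0 <= k < n) rank_one ip_norm (x k) (z k)) v) (S v).
Proof.
move=> C0 ox x1 oz zC.
have termE n v : (\sum_(0 <= k < n) rank_one ip_norm (x k) (z k)) v =
    \sum_(0 <= k < n) ip v (z k) *: x k.
  elim: n => [|n IH]; first by rewrite !big_nil.
  by rewrite !big_nat_recr// bopDE IH rank_oneE.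
have bz v n : \sum_(0 <= j < n) rnorm (ip v (z j)) ^+ 2 <= (rnorm v * C) ^+ 2.
  have := @bessel (fun u => ip u v) (rnorm v) C z (rnorm_ge0 _) C0 _ _ oz zC n.
  have -> : \sum_(0 <= j < n) rnorm (ip v (z j)) ^+ 2 = \sum_(0 <= j < n) rnorm (ip (z j) v) ^+ 2.
    by apply: eq_bigr => j _; rewrite ipC rnorm_conj.
  apply=> [a u w|u]; first by rewrite ipDl ipZl.
  by rewrite mulrC; exact: cauchy_schwarz.
have sx v m n : rnorm (\sum_(m <= k < n) ip v (z k) *: x k) ^+ 2 =
    \sum_(m <= k < n) rnorm (ip v (z k)) ^+ 2.
  rewrite sqr_rnorm_orthogonal_sum//; apply: eq_bigr => k _.
  by rewrite x1 expr1n mulr1.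
have /choice[f fP] v : exists l, rcvg (fun n => \sum_(0 <= k < n) ip v (z k) *: x k) l.
  apply: complete_rcomplete => e e0; have e2 : 0 < e ^+ 2 by rewrite exprn_gt0.
  have [N NP] := bounded_sum_cauchy (fun n => sqr_ge0 _) (bz v) e2.
  suff h m n : (N <= m)%N -> (m <= n)%N -> rnorm (\sum_(0 <= k < n) ip v (z k) *: x k -
      \sum_(0 <= k < m) ip v (z k) *: x k) < e.
    exists N => m n Nm Nn; have [mn|/ltnW nm] := leqP m n; last exact: h.
    by rewrite rdistC; exact: h.
  move=> Nm mn; rewrite [X in X - _](big_cat_nat (n := m))//= addrAC subrr add0r.
  by rewrite -(@ltr_pXn2r _ 2)// ?nnegrE ?rnorm_ge0 1?ltW// sx; exact: NP.
have [c u v|v|S SE] := @bop_of _ _ f C.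
- apply: (rcvg_unique (fP _)).
  have -> : (fun n => \sum_(0 <= k < n) ip (c *: u + v) (z k) *: x k) =
      (fun n => c *: (\sum_(0 <= k < n) ip u (z k) *: x k) + \sum_(0 <= k < n) ip v (z k) *: x k).
    apply/funext => n; rewrite scaler_sumr -big_split; apply: eq_bigr => k _ /=.
    by rewrite ipDl ipZl scalerDl scalerA.
  by apply: rcvgD => //; apply: rcvgZ.
- apply: (rcvg_rnorm_le (fP v)); exists 0%N => n _.
  rewrite -(@ler_pXn2r _ 2)// ?nnegrE ?rnorm_ge0 ?mulr_ge0 ?rnorm_ge0//.
  by rewrite sx mulrC.
exists S => v; rewrite SE.
by have -> : (fun n => (\sum_(0 <= k < n) rank_one ip_norm (x k) (z k)) v) =
  (fun n => \sum_(0 <= k < n) ip v (z k) *: x k) by apply/funext.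
Qed.

End Orthogonal.

(** * Block sequences against compactness and left invertibility *)

Section BlockSequences.
Variables (R : realType) (H : completeNormedModType R[i]).
Variables (ip : {dot H for Num.conj}) (ip_norm : forall x : H, ip x x = `|x| ^+ 2).
Variables (Ns : set (set H)) (Ns_nest : nest Ns).
Implicit Types (x z : nat -> H) (T S : bop H).

Local Notation A := (nest_alg Ns).
Local Notation rk1 := (rank_one ip_norm).

(** Successive blocks of [T] along a strictly monotone sequence of the nest,
    increasing if [up] and decreasing otherwise. *)
Record block_seq (up : bool) T (C : R) x z : Prop := BlockSeq {
  bs_gt0 : 0 < C;
  bs_unit : forall k, rnorm (x k) = 1;
  bs_bound : forall k, rnorm (z k) <= C;
  bs_orthx : orthogonal_seq ip x;
  bs_orthz : orthogonal_seq ip z;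
  bs_diag : forall k, ip (T (x k)) (z k) = 1;
  bs_alg : forall j k, (if up then (j < k)%N else (k < j)%N) -> A (rk1 (x j) (z k));
  bs_triang : forall j k, (if up then (j < k)%N else (k < j)%N) -> ip (T (x j)) (z k) = 0 }.

Lemma bs_app_ge up T C x z k : block_seq up T C x z -> C^-1 <= rnorm (T (x k)).
Proof.
move=> bs; have C0 := bs_gt0 bs.
have := cauchy_schwarz ip_norm (T (x k)) (z k); rewrite (bs_diag bs).
rewrite -(rmorph1 (real_complex R)) rnorm_real normr1 => h.
rewrite -[leLHS]mul1r ler_pdivrMr//; apply: le_trans h _.
by rewrite ler_wpM2l ?rnorm_ge0// (bs_bound bs).
Qed.

Lemma block_seq_not_compact up T C x z : A T -> block_seq up T C x z ->
  ~ totally_bounded [set T * s * T | s in A `&` @unit_ball R (bop H)].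
Proof.
move=> AT bs; have C0 := bs_gt0 bs; have Ci0 : 0 < C^-1 by rewrite invr_gt0.
have Ci1 := ltW Ci0.
(* The indices [p k] and [q k] are consecutive, in the order that puts the rank one operator in the
   algebra. *)
pose p k := if up then k else k.+1; pose q k := if up then k.+1 else k.
pose s k : bop H := (C^-1)%:C *: rk1 (x (p k)) (z (q k)).
have sE k v : (T * s k * T) v = (C^-1)%:C *: (ip (T v) (z (q k)) *: T (x (p k))).
  by rewrite !bopME /s bopZE rank_oneE !linearZ /= scalerA mulrC -scalerA.
have sq k : (T * s k * T) (x (q k)) = (C^-1)%:C *: T (x (p k)).
  by rewrite sE (bs_diag bs) scale1r.
have ssep v k l : rnorm v = 1 -> (T * s k * T) v = (C^-1)%:C *: T (x l) ->
    forall j, (T * s j * T) v = 0 -> C^-1 * C^-1 <= rnorm (T * s k * T - T * s j * T).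
  move=> v1 kv j jv; have := rnorm_app (T * s k * T - T * s j * T) v.
  rewrite v1 mulr1 bopBE kv jv subr0 rnormZ rnorm_real ger0_norm//.
  by apply: le_trans; rewrite ler_wpM2l// (bs_app_ge l bs).
apply: (@separated_not_totally_bounded _ _ _ (fun k => T * s k * T) (C^-1 * C^-1)).
- by rewrite mulr_gt0.
- move=> k; exists (s k) => //; split.
    by apply: algZ => //; apply: (bs_alg bs); rewrite /p /q; case: (up).
  rewrite /unit_ball /= /s rnormZ rnorm_real ger0_norm//.
  rewrite ler_pdivrMl// mulr1; apply: le_trans (rnorm_rank_one _ _ _) _.
  by rewrite (bs_unit bs) mul1r (bs_bound bs).
(* The test vector is taken on the side where triangularity kills the other operator: [x j.+1] for
   an increasing sequence and [x k] for a decreasing one. *)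
- move=> j k jk; have [upT|upF] := boolP up.
    apply: (ssep (x (q j)) j (p j) (bs_unit bs _) (sq j)).
    rewrite sE (bs_triang bs) ?scale0r ?scaler0// upT /q upT ltnS//.
  rewrite rdistC; apply: (ssep (x (q k)) k (p k) (bs_unit bs _) (sq k)).
  by rewrite sE (bs_triang bs) ?scale0r ?scaler0// (negPf upF) /q (negPf upF).
Qed.

Lemma block_seq_sub up T C x z (phi : nat -> nat) :
  (forall i j, (i < j)%N -> (phi i < phi j)%N) ->
  block_seq up T C x z -> block_seq up T C (x \o phi) (z \o phi).
Proof.
move=> phi_lt bs; have phi_inj j k : j != k -> phi j != phi k.
  by case: ltngtP => // /phi_lt h _; rewrite neq_ltn h ?orbT.
split; first exact: bs_gt0 bs.
- by move=> k; exact: bs_unit bs _.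
- by move=> k; exact: bs_bound bs _.
- by move=> j k /phi_inj; exact: bs_orthx bs _ _.
- by move=> j k /phi_inj; exact: bs_orthz bs _ _.
- by move=> k; exact: bs_diag bs _.
- by move=> j k jk; apply: (bs_alg bs); move: jk; case: (up) => /phi_lt.
- by move=> j k jk; apply: (bs_triang bs); move: jk; case: (up) => /phi_lt.
Qed.

(** For fixed [i], the Bessel inequality makes both [ip (T (x j)) (z i)] and [ip (T (x i)) (z j)]
    tend to 0 in [j]. A subsequence brings them below [4^-1 ^+ j] for [i < j], which is at most the
    symmetric bound. *)
Lemma block_seq_decay up T C x z : block_seq up T C x z ->
  exists phi : nat -> nat, block_seq up T C (x \o phi) (z \o phi) /\
    forall i j, i != j ->
      rnorm (ip (T (x (phi i))) (z (phi j))) <= 2^-1 ^+ i * 2^-1 ^+ j.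
Proof.
move=> bs; have C0 := ltW (bs_gt0 bs).
pose b i j := rnorm (ip (T (x j)) (z i)) + rnorm (ip (T (x i)) (z j)).
have b0 i e : 0 < e -> exists N, forall j, (N <= j)%N -> b i j < e.
  move=> e0; have e2 : 0 < e / 2 by lra.
  have [||||N NP] := @bessel_vanish _ _ _ ip_norm (fun v => ip (T v) (z i)) (rnorm T * C) 1 x
    _ ler01 _ _ (bs_orthx bs) _ _ e2.
  - by rewrite mulr_ge0 ?rnorm_ge0.
  - by move=> a u v; rewrite linearP ipDl ipZl.
  - move=> v; apply: le_trans (cauchy_schwarz ip_norm _ _) _.
    rewrite mulrAC; apply: ler_pM; rewrite ?rnorm_ge0 ?rnorm_app ?(bs_bound bs)//.
  - by move=> k; rewrite (bs_unit bs).
  have [||M MP] := @bessel_vanish _ _ _ ip_norm (fun v => ip v (T (x i))) (rnorm (T (x i))) C z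
    (rnorm_ge0 _) C0 _ _ (bs_orthz bs) (bs_bound bs) _ e2.
  - by move=> a u v; rewrite ipDl ipZl.
  - by move=> v; rewrite mulrC; exact: cauchy_schwarz.
  exists (maxn N M) => j; rewrite geq_max => /andP[/NP + /MP].
  by rewrite /b [ip (T (x i)) _]ipC rnorm_conj; lra.
have eta0 n : 0 < 4^-1 ^+ n :> R by rewrite exprn_gt0// invr_gt0.
have [phi [phi_lt bphi]] := small_subsequence eta0 b0.
exists phi; split; first exact: block_seq_sub.
have h2 : 4^-1 = 2^-1 ^+ 2 :> R by rewrite expr2 -invfM -natrM.
have hle (i j : nat) : (i < j)%N -> 4^-1 ^+ j <= 2^-1 ^+ i * 2^-1 ^+ j :> R.
  move=> ij; rewrite h2 -exprM -exprD ler_wiXn2l//; try lra; lia.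
move=> i j; case: ltngtP => // ij _.
  have := bphi _ _ ij; rewrite /b; have := hle _ _ ij.
  have := rnorm_ge0 (ip (T (x (phi j))) (z (phi i))); lra.
have := bphi _ _ ij; rewrite /b mulrC; have := hle _ _ ij.
have := rnorm_ge0 (ip (T (x (phi j))) (z (phi i))); lra.
Qed.

(** With [S = sum_k x_k (x) z_(k+1)] (or [sum_k x_(k+1) (x) z_k] when the
    sequence is decreasing), [S T] is summably close to a shift on the [x_k],
    so that [1 - S T] is bounded on the long sums [x_0 + ... + x_n]. *)
Lemma block_seq_not_left_invertible up T C x z : A T -> block_seq up T C x z ->
  exists2 S, A S & forall B, B * (1 - S * T) <> 1.
Proof.
move=> AT /block_seq_decay[phi []].
set x' := x \o phi; set z' := z \o phi => bs bdec.
have C0 := ltW (bs_gt0 bs).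
pose p k := if up then k else k.+1; pose q k := if up then k.+1 else k.
have p_inj j k : j != k -> p j != p k by rewrite /p; case: (up).
have q_inj j k : j != k -> q j != q k by rewrite /q; case: (up).
have [S SP] := @rank_one_series _ _ _ ip_norm (x' \o p) (z' \o q) C C0
  (fun j k jk => bs_orthx bs (p_inj _ _ jk)) (fun k => bs_unit bs _)
  (fun j k jk => bs_orthz bs (q_inj _ _ jk)) (fun k => bs_bound bs _).
exists S.
  (* The series converges only strongly, which is enough since each [N] is closed. *)
  apply/nest_algP => N v NN Nv.
  apply: (rcvg_closed (nest_closed Ns_nest NN) _ (SP v)) => n.
  suff /nest_algP : A (\sum_(0 <= k < n) rk1 ((x' \o p) k) ((z' \o q) k)) by exact.
  apply: subspace_sum; first exact: alg_subspace.
  by move=> k _; apply: (bs_alg bs); rewrite /p /q; case: (up).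
(* The diagonal coefficient yields [x' (p k)] exactly; the error collects the off-diagonal ones,
   summable by the decay. *)
have Serr k : rnorm (S (T (x' (q k))) - x' (p k)) <= 2 * 2^-1 ^+ k.
  apply: (@rcvg_rnorm_le _ _ (fun n => (\sum_(0 <= j < n) rk1 ((x' \o p) j) ((z' \o q) j))
    (T (x' (q k))) - x' (p k))); first exact: rcvg_subr.
  exists k.+1 => n kn.
  have -> : (\sum_(0 <= j < n) rk1 ((x' \o p) j) ((z' \o q) j)) (T (x' (q k))) - x' (p k) =
      \sum_(0 <= j < n | j != k) ip (T (x' (q k))) (z' (q j)) *: x' (p j).
    apply/eqP; rewrite subr_eq addrC; apply/eqP.
    transitivity (\sum_(0 <= j < n) ip (T (x' (q k))) (z' (q j)) *: x' (p j)).
      elim: n {kn} => [|n IH]; first by rewrite !big_nil.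
      by rewrite !big_nat_recr// bopDE IH rank_oneE.
    rewrite (bigD1_seq k) /= ?iota_uniq ?mem_index_iota//.
    by rewrite (bs_diag bs) scale1r.
  apply: le_trans (rnorm_sum _ _ _) _.
  apply: (@le_trans _ _ (\sum_(0 <= j < n) 2^-1 ^+ k * 2^-1 ^+ j)); last first.
    by apply: geometric_sum_le; rewrite exprn_ge0//; lra.
  rewrite big_mkcond /=; apply: ler_sum => j _.
  have pow0 i : 0 <= 2^-1 ^+ i :> R by rewrite exprn_ge0//; lra.
  case: ifP => [jk|_]; last by rewrite mulr_ge0.
  rewrite rnormZ (bs_unit bs) mulr1; apply: le_trans (bdec _ _ _) _.
    by apply: q_inj; rewrite eq_sym.
  apply: ler_pM => //; rewrite ler_wiXn2l//; try lra; rewrite /q; case: (up) => //.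
move=> B BS.
(* The sum [u] of [n] orthonormal vectors has norm the square root of [n], while [(1 - S * T) u] is
   a telescoping sum of norm at most 2 minus errors of total norm at most 4. A left inverse [B]
   would bound all these square roots. *)
have bound n : Num.sqrt n%:R <= rnorm B * 6.
  pose u := \sum_(0 <= k < n) x' (q k).
  have nu : rnorm u = Num.sqrt n%:R.
    apply/eqP; rewrite -(@eqrXn2 _ 2)// ?rnorm_ge0 ?sqrtr_ge0// sqr_sqrtr ?ler0n//.
    have -> : u = \sum_(0 <= k < n) 1 *: (x' \o q) k.
      by apply: eq_bigr => k _; rewrite scale1r.
    rewrite (@sqr_rnorm_orthogonal_sum _ _ _ ip_norm _ (fun=> 1)); last first.
      by move=> j k jk; apply: (bs_orthx bs); exact: q_inj.
    rewrite (eq_bigr (fun=> 1)) ?big_const_nat ?subn0 ?iter_addr_0// => k _.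
    by rewrite /= (bs_unit bs) -(rmorph1 (real_complex R)) rnorm_real normr1 !expr1n mulr1.
  have tele : rnorm (\sum_(0 <= k < n) (x' (q k) - x' (p k))) <= 2.
    have h : rnorm (\sum_(0 <= k < n) (x' k.+1 - x' k)) <= 2.
      rewrite telescope_sumr//; apply: le_trans (rnormB _ _) _.
      by rewrite !(bs_unit bs).
    rewrite /p /q; case: (up) => //.
    rewrite -rnormN -sumrN; under eq_bigr do rewrite opprB.
    exact: h.
  have err : rnorm (\sum_(0 <= k < n) (S (T (x' (q k))) - x' (p k))) <= 4.
    apply: le_trans (rnorm_sum _ _ _) _.
    apply: (@le_trans _ _ (\sum_(0 <= k < n) 2 * 2^-1 ^+ k)); first exact: ler_sum.
    by apply: le_trans (geometric_sum_le _ _) _ => //; lra.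
  rewrite -nu; have -> : u = B ((1 - S * T) u) by rewrite -bopME BS.
  apply: le_trans (rnorm_app _ _) _; rewrite ler_wpM2l ?rnorm_ge0//.
  have -> : (1 - S * T) u = \sum_(0 <= k < n) (x' (q k) - x' (p k)) -
      \sum_(0 <= k < n) (S (T (x' (q k))) - x' (p k)).
    have STu : S (T u) = \sum_(0 <= k < n) S (T (x' (q k))) by rewrite /u !linear_sum.
    rewrite !bopE STu /u -!sumrB; apply: eq_bigr => k _.
    by rewrite opprB addrA subrK.
  by have := rnormB (\sum_(0 <= k < n) (x' (q k) - x' (p k)))
    (\sum_(0 <= k < n) (S (T (x' (q k))) - x' (p k))); lra.
have B6 : 0 <= rnorm B * 6 by rewrite mulr_ge0 ?rnorm_ge0.
have := bound (Num.truncn ((rnorm B * 6) ^+ 2)).+1.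
rewrite -(@ler_pXn2r _ 2)// ?nnegrE ?sqrtr_ge0// sqr_sqrtr ?ler0n//.
by rewrite leNgt Num.Theory.truncnS_gt.
Qed.

End BlockSequences.

(** * Block sequences at limit points of a nest *)

Section Approximation.
Variables (R : realType) (H : completeNormedModType R[i]).
Variables (ip : {dot H for Num.conj}) (ip_norm : forall x : H, ip x x = `|x| ^+ 2).
Variables (Ns : set (set H)) (Ns_nest : nest Ns).
Implicit Types (x y z v w : H) (M N L : set H) (S T : bop H) (F : set (set H)).

Local Notation A := (nest_alg Ns).
Local Notation P := (nproj ip_norm).
Local Notation E := (nint ip_norm).
Local Notation nproj_in := (nproj_in ip_norm Ns_nest).
Local Notation nproj_id := (nproj_id ip_norm Ns_nest).
Local Notation nproj_ortho := (nproj_ortho ip_norm Ns_nest).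
Local Notation nproj_perp := (nproj_perp ip_norm Ns_nest).
Local Notation rnorm_nproj := (rnorm_nproj ip_norm Ns_nest).
Local Notation rnorm_conproj := (rnorm_conproj ip_norm Ns_nest).
Local Notation nint_app := (nint_app ip_norm Ns_nest).
Local Notation nint_projl := (nint_projl ip_norm Ns_nest).
Local Notation nint_proj0l := (nint_proj0l ip_norm Ns_nest).
Local Notation rnorm_nint_app := (rnorm_nint_app ip_norm Ns_nest).
Local Notation nint_idem := (nint_idem ip_norm Ns_nest).

Lemma closure_subspace (M : set H) : linear_subspace M -> linear_subspace (closure M).
Proof.
move=> [M0 MD MZ]; split; first exact: subset_closure.
- move=> x y /closureP clx /closureP cly; apply/closureP => e e0.
  have e2 : 0 < e / 2 by lra.
  have [x' Mx' xx'] := clx _ e2; have [y' My' yy'] := cly _ e2.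
  exists (x' + y'); first exact: MD.
  by rewrite opprD addrACA; have := rnormD (x - x') (y - y'); lra.
- move=> c x /closureP clx; apply/closureP => e e0.
  have c1 : 0 < rnorm c + 1 by rewrite ltr_wpDl ?rnorm_ge0.
  have [x' Mx' xx'] := clx _ (divr_gt0 e0 c1).
  exists (c *: x'); first exact: MZ.
  rewrite -scalerBr rnormZ; move: xx'; rewrite ltr_pdivlMr// mulrC.
  by apply: le_lt_trans; rewrite ler_wpM2r ?rnorm_ge0// lerDl.
Qed.

Lemma closure_perp (M : set H) z : (forall x, M x -> ip x z = 0) ->
  forall x, closure M x -> ip x z = 0.
Proof.
move=> Mz x /closureP clx; apply: rnorm0_eq0; apply/eqP.
rewrite eq_le rnorm_ge0 andbT; apply/ler_addgt0Pr => e e0; rewrite add0r.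
have z1 : 0 < rnorm z + 1 by rewrite ltr_wpDl ?rnorm_ge0.
have [y My xy] := clx _ (divr_gt0 e0 z1).
have -> : ip x z = ip (x - y) z by rewrite ipBl (Mz y)// subr0.
apply: le_trans (cauchy_schwarz ip_norm _ _) _.
move: xy; rewrite ltr_pdivlMr// => /ltW; apply: le_trans.
by rewrite ler_wpM2l ?rnorm_ge0// lerDl.
Qed.

(** This also holds of [[set 0]], where the family is empty, as [right_limit] does of [[set: H]];
    hence the side conditions in the lemmas below. *)
Definition left_limit N := N = closed_span (\bigcup_(M in [set M | [/\ Ns M, M `<=` N & M <> N]]) M).
Definition right_limit N := N = \bigcap_(M in [set M | [/\ Ns M, N `<=` M & M <> N]]) M.

Lemma left_limit_approx N v (e : R) : Ns N -> N <> [set 0] -> left_limit N -> N v -> 0 < e ->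
  exists M w, [/\ Ns M, M `<=` N, M <> N, M w & rnorm (v - w) < e].
Proof.
move=> NN N0; rewrite /left_limit; set F := [set M | _]; move=> limN.
move=> Nv e0; move: (Nv); rewrite {1}limN => /closureP clv.
have [w] := clv _ e0.
have sF : linear_subspace (\bigcup_(M in F) M).
  apply: chain_union_subspace.
  - exists [set 0]; split; [exact: (nest0 Ns_nest)|exact: (nest0_sub Ns_nest NN)|exact: nesym].
  - by move=> M [NM _ _]; exact: (nest_subspace Ns_nest).
  - by move=> M M' [NM _ _] [NM' _ _]; exact: (nest_total Ns_nest).
move=> sw vw; have [M [NM MN MnN] Mw] := sw _ (conj sF (@subset_refl _ _)).
by exists M, w; split.
Qed.

Lemma perp_subspace M : linear_subspace [set v | forall m, M m -> ip v m = 0].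
Proof.
split=> [m _|x y xM yM m Mm|c x xM m Mm]; first by rewrite ip0l.
  by rewrite ipDl xM// yM// addr0.
by rewrite ipZl xM// mulr0.
Qed.

(** The orthogonal complements of the members above [N] form a chain whose union is dense in that of
    [N]: the residual [v - p] is orthogonal to each of them, so it lies in every such member and
    thus in [N], to which [v] and [p] are orthogonal. *)
Lemma right_limit_approx N v (e : R) : Ns N -> N <> [set: H] -> right_limit N ->
  (forall m, N m -> ip v m = 0) -> 0 < e ->
  exists M w, [/\ Ns M, N `<=` M, M <> N, forall m, M m -> ip w m = 0 & rnorm (v - w) < e].
Proof.
move=> NN NT; rewrite /right_limit; set F := [set M | _]; move=> limN vN e0.
pose G := (fun M => [set u | forall m, M m -> ip u m = 0]) @` F.
have sU : linear_subspace (\bigcup_(U in G) U).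
  apply: chain_union_subspace.
  - exists [set u | forall m, [set: H] m -> ip u m = 0], [set: H] => //.
    by split=> //; [exact: (nestT Ns_nest)|exact: nesym].
  - by move=> _ [M _ <-]; exact: perp_subspace.
  - move=> _ _ [M [NM _ _] <-] [M' [NM' _ _] <-].
    have [MM'|M'M] := nest_total Ns_nest NM NM'; [right|left] => u uM m Mm.
      by apply: uM; exact: MM'.
    by apply: uM; exact: M'M.
have [p clp vp] := projection_theorem ip_norm v (closure_subspace sU) (@closed_closure _ _).
have wN : N (v - p).
  rewrite limN => M FM; have NM : Ns M by case: FM.
  suff : v - p - P M (v - p) = 0.
    by move/eqP; rewrite subr_eq0 => /eqP ->; exact: (nproj_in NM).
  set w := v - p; apply: (ip_eq0 ip_norm).
  rewrite [X in X = _]ipBr [X in _ - X](nproj_ortho NM) ?subr0; last first.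
    exact: (nproj_in NM).
  apply: ip_eq0C; apply: vp; apply: subset_closure.
  exists [set u | forall m, M m -> ip u m = 0]; first by exists M.
  by move=> m Mm; exact: nproj_ortho.
have pN m : N m -> ip p m = 0.
  move=> Nm; apply: closure_perp clp => u [_ [M [NM NM' _] <-] uM].
  by apply: uM; exact: NM'.
have vpE : v = p.
  apply/eqP; rewrite -subr_eq0; apply/eqP/(ip_eq0 ip_norm).
  by rewrite [LHS]ipBl vN// pN// subr0.
move: clp; rewrite -vpE => /closureP/(_ _ e0)[w [_ [M [NM NM' MnN] <-] wM] vw].
by exists M, w.
Qed.

(** The scaled second vector has norm [rnorm x / rnorm y], which the strict inequality keeps below
    [d^-1]. *)
Lemma normalize_block T x y (d : R) : 0 < d -> d * rnorm x < rnorm y ->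
  ip (T x) y = (rnorm y ^+ 2)%:C ->
  exists a b : R, [/\ rnorm (a%:C *: x) = 1, rnorm (b%:C *: y) <= d^-1 &
    ip (T (a%:C *: x)) (b%:C *: y) = 1].
Proof.
move=> d0 dxy Txy.
have y0 : 0 < rnorm y by apply: le_lt_trans dxy; rewrite mulr_ge0 ?rnorm_ge0 ?ltW.
have x0 : 0 < rnorm x.
  rewrite rnorm_gt0; apply/eqP => x0; move: Txy; rewrite x0 linear0 ip0l.
  by move=> /(@complexI R 0)/esym/eqP; rewrite expf_eq0 gt_eqF.
exists (rnorm x)^-1, (rnorm x / rnorm y ^+ 2); split.
- by rewrite rnormZ rnorm_real ger0_norm ?invr_ge0 ?rnorm_ge0// mulVf// gt_eqF.
- rewrite rnormZ rnorm_real ger0_norm ?divr_ge0 ?sqr_ge0 ?rnorm_ge0//.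
  have -> : rnorm x / rnorm y ^+ 2 * rnorm y = rnorm x / rnorm y.
    by field; rewrite gt_eqF.
  rewrite ler_pdivrMr// ler_pdivlMl// ltW//.
- rewrite [T _]linearZ /= ipZl ipZr Txy conjc_real -!rmorphM /=.
  have -> : (rnorm x)^-1 * (rnorm x / rnorm y ^+ 2 * rnorm y ^+ 2) = 1.
    by field; rewrite !gt_eqF.
  by rewrite rmorph1.
Qed.

Lemma compr_large_vector M N T (d : R) : Ns M -> Ns N -> M `<=` N -> 0 < d ->
  d < rnorm (compr ip_norm M N T) ->
  exists v, E M N v = v /\ d * rnorm v < rnorm (E M N (T v)).
Proof.
move=> NM NN MN d0 dT; apply: contrapT => nv; move: dT; apply/negP; rewrite -leNgt.
apply: rnorm_bop => [|v]; first exact: ltW.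
have EE : E M N (E M N v) = E M N v by rewrite -bopME nint_idem.
have : rnorm (E M N (T (E M N v))) <= d * rnorm (E M N v).
  by rewrite leNgt; apply/negP => h; apply: nv; exists (E M N v).
move=> /le_trans; apply; rewrite ler_wpM2l ?(ltW d0)//.
exact: rnorm_nint_app.
Qed.

(** A vector [v] of the interval on which the compression is large is moved slightly into a smaller
    member [M']. As [T] preserves [M'], the part [y] of [T x] orthogonal to [M] stays in [M'] and
    serves as test vector. *)
Lemma left_limit_step N T (d : R) : A T -> Ns N -> N <> [set 0] -> left_limit N -> 0 < d ->
  (forall M, Ns M -> M `<=` N -> M <> N -> d < rnorm (compr ip_norm M N T)) ->
  forall M, Ns M /\ M `<=` N /\ M <> N -> exists t : set H * H * H,
    let: (M', x, z) := t in
    [/\ Ns M', M' `<=` N, M' <> N & M `<=` M'] /\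
    [/\ M' x, M' z, forall m, M m -> ip x m = 0 & forall m, M m -> ip z m = 0] /\
    [/\ rnorm x = 1, rnorm z <= d^-1 & ip (T x) z = 1].
Proof.
move=> AT NN N0 limN d0 Tlarge M [NM [MN MnN]].
have [v [Ev vlarge]] := compr_large_vector NM NN MN d0 (Tlarge _ NM MN MnN).
(* The margin in the strict inequality. Moving [v] by less than [g / (rnorm T + d)] changes the two
   sides by less than [g] in total. *)
set g := rnorm (E M N (T v)) - d * rnorm v.
have g0 : 0 < g by rewrite subr_gt0.
have D0 : 0 < rnorm T + d by rewrite ltr_wpDl ?rnorm_ge0.
have eta0 := divr_gt0 g0 D0.
have Nv : N v.
  by rewrite -Ev -(nint_projl NM NN MN) bopME; exact: nproj_in.
have PMv : P M v = 0.
  by rewrite -Ev -bopME nint_proj0l.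
have [M1 [w [NM1 M1N M1nN M1w vw]]] := left_limit_approx NN N0 limN Nv eta0.
(* The larger of [M] and [M1] contains both [M] and the approximant. *)
have [M' [NM' M'N M'nN MM' M'w]] : exists M', [/\ Ns M', M' `<=` N, M' <> N, M `<=` M' & M' w].
  have [MM1|M1M] := nest_total Ns_nest NM NM1; first by exists M1; split=> //; exact: M1w.
  by exists M; split=> //; exact: M1M.
have sM' := nest_subspace Ns_nest NM'.
pose x := w - P M w; pose y := T x - P M (T x).
have PM_M' u : M' (P M u) by apply: MM'; exact: nproj_in.
have M'x : M' x by exact: subspaceB.
have M'y : M' y.
  by apply: subspaceB => //; move/nest_algP: AT; apply.
have xM m : M m -> ip x m = 0 by exact: nproj_ortho.
have yM m : M m -> ip y m = 0 by exact: nproj_ortho.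
have xv : rnorm (x - v) < g / (rnorm T + d).
  have -> : x - v = (w - v) - P M (w - v).
    by rewrite [P M (w - v)]linearB /= PMv subr0 /x addrAC.
  by apply: le_lt_trans (rnorm_conproj NM _) _; rewrite // rdistC.
have yE : rnorm (E M N (T v) - y) <= rnorm T * rnorm (x - v).
  have -> : E M N (T v) - y = T (v - x) - P M (T (v - x)).
    rewrite (nint_app NM NN MN) nproj_id//; last first.
      by move/nest_algP: AT; apply.
    by rewrite /y [T (v - x)]linearB [P M (T v - T x)]linearB [in LHS]opprD addrACA -opprD.
  by apply: le_trans (rnorm_conproj NM _) _; rewrite // rdistC rnorm_app.
have xy : d * rnorm x < rnorm y.
  have h1 := rnormD (x - v) v; rewrite subrK in h1.
  have h2 := rnormD (E M N (T v) - y) y; rewrite subrK in h2.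
  move: xv; rewrite ltr_pdivlMr// mulrDr => xv.
  have h3 : d * rnorm x <= d * rnorm (x - v) + d * rnorm v.
    by rewrite -mulrDr ler_wpM2l// ltW.
  by rewrite /g in xv; lra.
have Txy : ip (T x) y = (rnorm y ^+ 2)%:C.
  rewrite -(ipxx ip_norm) -[T x in LHS](subrK (P M (T x))) ipDl -/y.
  by rewrite [ip (P M _) _]ip_eq0C ?addr0// yM//; exact: nproj_in.
have [a [b [x1 zb xz]]] := normalize_block d0 xy Txy.
have [_ _ M'Z] := sM'.
exists (M', a%:C *: x, b%:C *: y); split=> //; split=> //; split; [exact: M'Z|exact: M'Z| |].
- by move=> m Mm; rewrite ipZl xM// mulr0.
- by move=> m Mm; rewrite ipZl yM// mulr0.
Qed.

(** Here invariance of [M'] does not help, as the blocks must be orthogonal to [M']: both [v] and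
    the compressed image [w] have to be approximated by vectors orthogonal to a member above [N],
    and [M'] lies below [M] and the two members so obtained. *)
Lemma right_limit_step N T (d : R) : A T -> Ns N -> N <> [set: H] -> right_limit N -> 0 < d ->
  (forall M, Ns M -> N `<=` M -> M <> N -> d < rnorm (compr ip_norm N M T)) ->
  forall M, Ns M /\ N `<=` M /\ M <> N -> exists t : set H * H * H,
    let: (M', x, z) := t in
    [/\ Ns M', N `<=` M', M' <> N & M' `<=` M] /\
    [/\ M x, M z, forall m, M' m -> ip x m = 0 & forall m, M' m -> ip z m = 0] /\
    [/\ rnorm x = 1, rnorm z <= d^-1 & ip (T x) z = 1].
Proof.
move=> AT NN N0 limN d0 Tlarge M [NM [NMs MnN]].
have [v [Ev vlarge]] := compr_large_vector NN NM NMs d0 (Tlarge _ NM NMs MnN).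
have /nest_algP ATP := AT.
have [w wE] : exists w, w = E N M (T v) by exists (E N M (T v)).
rewrite -wE in vlarge.
set g := rnorm w - d * rnorm v.
have g0 : 0 < g by rewrite subr_gt0.
(* The extra 1 pays for the approximation of [w]. *)
have D0 : 0 < 1 + rnorm T + d by have := rnorm_ge0 T; lra.
have eta0 := divr_gt0 g0 D0; set eta := g / _ in eta0.
have Mv : M v.
  by rewrite -Ev -(nint_projl NN NM NMs) bopME; exact: nproj_in.
have wPN : w = T v - P N (T v).
  by rewrite wE (nint_app NN NM NMs) [P M (T v)](nproj_id NM)//; apply: ATP.
have EN u m : N m -> ip (E N M u) m = 0.
  move=> Nm; rewrite (nint_app NN NM NMs).
  exact: nproj_ortho.
have vN m : N m -> ip v m = 0 by rewrite -Ev; exact: EN.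
have wN m : N m -> ip w m = 0 by rewrite wE; exact: EN.
have [M1 [v1 [NM1 NM1s M1nN v1M1 vv1]]] := right_limit_approx NN N0 limN vN eta0.
have [M2 [w2 [NM2 NM2s M2nN w2M2 ww2]]] := right_limit_approx NN N0 limN wN eta0.
have [M' [NM' NM's M'nN [M'M M'M1 M'M2]]] : exists M', [/\ Ns M', N `<=` M', M' <> N &
    [/\ M' `<=` M, M' `<=` M1 & M' `<=` M2]].
  have tot := nest_total Ns_nest.
  have [M12|M21] := tot _ _ NM1 NM2.
    have [MM1|M1M] := tot _ _ NM NM1.
      by exists M; split=> //; split=> //; exact: subset_trans M12.
    by exists M1; split=> //; split.
  have [MM2|M2M] := tot _ _ NM NM2; last by exists M2; split=> //; split.
  by exists M; split=> //; split=> //; exact: subset_trans M21.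
have sM := nest_subspace Ns_nest NM.
pose x := P M v1; pose y := T x - P M' (T x).
have Mx : M x by exact: nproj_in.
have My : M y.
  by apply: subspaceB => //; [exact: ATP|apply: M'M; exact: nproj_in].
have xM' m : M' m -> ip x m = 0.
  move=> M'm; have -> : x = v1 - (v1 - P M v1) by rewrite opprB addrC subrK.
  by rewrite ipBl v1M1 ?sub0r; [rewrite nproj_ortho ?oppr0//; exact: M'M|exact: M'M1].
have yM' m : M' m -> ip y m = 0 by exact: nproj_ortho.
have xv : rnorm (x - v) < eta.
  have -> : x - v = P M (v1 - v) by rewrite [P M (v1 - v)]linearB /= (nproj_id NM Mv).
  by apply: le_lt_trans (rnorm_nproj NM _) _; rewrite // rdistC.
have PTv : P M' (T v) = P N (T v) + P M' w.
  rewrite wPN [P M' (T v - _)]linearB /= (nproj_id NM' (x := P N (T v))) 1?addrC ?subrK//.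
  by apply: NM's; exact: nproj_in.
have zmod_id (a b c t p : H) : a - b - (t - p) = c + (a - t - (b + c - p)).
  rewrite [b + c - p]addrAC [b - p + c]addrC [- (c + _)]opprD addrCA addNKr.
  by rewrite [- (t - p)]opprD addrACA -opprD.
(* The vector [w] exceeds the part of [T v] orthogonal to [M'] by [P M' w], which is small because
   [P M' w2 = 0]. *)
have yE : rnorm (w - y) <= eta + rnorm T * rnorm (x - v).
  have -> : w - y = P M' (w - w2) + (T (v - x) - P M' (T (v - x))).
    rewrite [P M' (w - w2)]linearB [T (v - x)]linearB [P M' (T v - T x)]linearB /=.
    rewrite [P M' w2](nproj_perp NM'); last first.
      by move=> m Mm; apply: w2M2; exact: M'M2.
    by rewrite subr0 PTv {1}wPN; exact: zmod_id.
  apply: le_trans (rnormD _ _) _; apply: lerD.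
    by apply: le_trans (rnorm_nproj NM' _) _; rewrite // ltW.
  by apply: le_trans (rnorm_conproj NM' _) _; rewrite // rdistC rnorm_app.
have xy : d * rnorm x < rnorm y.
  have h1 := rnormD (x - v) v; rewrite subrK in h1.
  have h2 := rnormD (w - y) y; rewrite subrK in h2.
  have h3 : d * rnorm x <= d * rnorm (x - v) + d * rnorm v.
    by rewrite -mulrDr ler_wpM2l// ltW.
  have h4 : d * rnorm (x - v) <= d * eta by rewrite ler_wpM2l// ltW.
  have h5 : rnorm T * rnorm (x - v) <= rnorm T * eta by rewrite ler_wpM2l ?rnorm_ge0// ltW.
  have h6 : eta + rnorm T * eta + d * eta = g.
    by rewrite /eta; field; rewrite gt_eqF.
  have h7 : d * rnorm (x - v) < d * eta by rewrite ltr_pM2l.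
  by rewrite /g in h6; lra.
have Txy : ip (T x) y = (rnorm y ^+ 2)%:C.
  rewrite -(ipxx ip_norm) -[T x in LHS](subrK (P M' (T x))) ipDl -/y.
  by rewrite [ip (P M' _) _]ip_eq0C ?addr0// yM'//; exact: nproj_in.
have [a [b [x1 zb xz]]] := normalize_block d0 xy Txy.
have [_ _ MZ] := sM.
exists (M', a%:C *: x, b%:C *: y); split=> //; split=> //; split; [exact: MZ|exact: MZ| |].
- by move=> m Mm; rewrite ipZl xM'// mulr0.
- by move=> m Mm; rewrite ipZl yM'// mulr0.
Qed.

(** Iterating the step from [[set 0]] puts [x k] and [z k] in [m k.+1], orthogonal to [m k]. For
    [j < k] the vector [T (x j)] stays in [m k], whence triangularity. *)
Lemma left_limit_block_seq N T (d : R) : A T -> Ns N -> N <> [set 0] -> left_limit N -> 0 < d ->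
  (forall M, Ns M -> M `<=` N -> M <> N -> d < rnorm (compr ip_norm M N T)) ->
  exists x z : nat -> H, block_seq ip_norm Ns true T d^-1 x z.
Proof.
move=> AT NN N0 limN d0 Tlarge; have /nest_algP ATP := AT.
pose good M := Ns M /\ M `<=` N /\ M <> N.
(* Choice needs a total function, so sets that are not [good] get a default triple; the iteration
   never meets them. *)
have /choice[f fP] (M : set H) : exists t : set H * H * H, good M ->
    let: (M', x, z) := t in
    [/\ Ns M', M' `<=` N, M' <> N & M `<=` M'] /\
    [/\ M' x, M' z, forall m, M m -> ip x m = 0 & forall m, M m -> ip z m = 0] /\
    [/\ rnorm x = 1, rnorm z <= d^-1 & ip (T x) z = 1].
  have [gM|ngM] := pselect (good M); last by exists (M, 0, 0).
  by have [t tP] := left_limit_step AT NN N0 limN d0 Tlarge gM; exists t.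
pose m k := iter k (fun M => (f M).1.1) [set 0].
pose x k := (f (m k)).1.2; pose z k := (f (m k)).2.
have gm k : good (m k).
  elim: k => [|k /fP]; first by split; [exact: (nest0 Ns_nest)|split; [exact: (nest0_sub Ns_nest NN)|exact: nesym]].
  by rewrite /m iterS -/(m k); case: (f (m k)) => [[M' ?] ?] /= [[? ? ? ?] _].
have fm k : [/\ Ns (m k.+1), m k.+1 `<=` N, m k.+1 <> N & m k `<=` m k.+1] /\
    [/\ m k.+1 (x k), m k.+1 (z k), forall v, m k v -> ip (x k) v = 0 &
        forall v, m k v -> ip (z k) v = 0] /\
    [/\ rnorm (x k) = 1, rnorm (z k) <= d^-1 & ip (T (x k)) (z k) = 1].
  have := fP _ (gm k); rewrite /x /z /m iterS -/(m k).
  by case: (f (m k)) => [[M' ?] ?].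
have mono j k : (j <= k)%N -> m j `<=` m k.
  elim: k => [|k IH]; first by rewrite leqn0 => /eqP ->.
  rewrite leq_eqVlt => /predU1P[->//|/IH jk]; apply: subset_trans jk _.
  by have [[_ _ _]] := fm k.
have Nm k : Ns (m k) by case: (gm k).
have mx j k : (j < k)%N -> m k (x j).
  by move=> jk; apply: mono jk _ _; have [_ [[]]] := fm j.
have mz j k : (j < k)%N -> m k (z j).
  by move=> jk; apply: mono jk _ _; have [_ [[]]] := fm j.
have xp k v : m k v -> ip (x k) v = 0 by have [_ [[_ _ h _] _]] := fm k; exact: h.
have zp k v : m k v -> ip (z k) v = 0 by have [_ [[_ _ _ h] _]] := fm k; exact: h.
exists x, z; split; first by rewrite invr_gt0.
- by move=> k; have [_ [_ []]] := fm k.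
- by move=> k; have [_ [_ []]] := fm k.
- move=> j k; case: ltngtP => // jk _; last by apply: xp; exact: mx.
  by apply: ip_eq0C; apply: xp; exact: mx.
- move=> j k; case: ltngtP => // jk _; last by apply: zp; exact: mz.
  by apply: ip_eq0C; apply: zp; exact: mz.
- by move=> k; have [_ [_ []]] := fm k.
- move=> j k jk; apply: (alg_rank_one Ns_nest (Nm k) (Nm k)).
  + by move=> L NL; exact: (nest_total Ns_nest).
  + exact: mx.
  + by move=> v mv; apply: ip_eq0C; exact: zp.
- move=> j k jk; apply: ip_eq0C; apply: zp; apply: ATP => //; exact: mx.
Qed.

(** Here the iteration descends from [[set: H]], and the blocks lie in [m k], orthogonal to
    [m k.+1]; hence the shifted indices in the membership of the rank one operators. *)
Lemma right_limit_block_seq N T (d : R) : A T -> Ns N -> N <> [set: H] -> right_limit N -> 0 < d ->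
  (forall M, Ns M -> N `<=` M -> M <> N -> d < rnorm (compr ip_norm N M T)) ->
  exists x z : nat -> H, block_seq ip_norm Ns false T d^-1 x z.
Proof.
move=> AT NN N0 limN d0 Tlarge; have /nest_algP ATP := AT.
pose good M := Ns M /\ N `<=` M /\ M <> N.
have /choice[f fP] (M : set H) : exists t : set H * H * H, good M ->
    let: (M', x, z) := t in
    [/\ Ns M', N `<=` M', M' <> N & M' `<=` M] /\
    [/\ M x, M z, forall m, M' m -> ip x m = 0 & forall m, M' m -> ip z m = 0] /\
    [/\ rnorm x = 1, rnorm z <= d^-1 & ip (T x) z = 1].
  have [gM|ngM] := pselect (good M); last by exists (M, 0, 0).
  by have [t tP] := right_limit_step AT NN N0 limN d0 Tlarge gM; exists t.
pose m k := iter k (fun M => (f M).1.1) [set: H].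
pose x k := (f (m k)).1.2; pose z k := (f (m k)).2.
have gm k : good (m k).
  elim: k => [|k /fP]; first by split; [exact: (nestT Ns_nest)|split=> //; exact: nesym].
  by rewrite /m iterS -/(m k); case: (f (m k)) => [[M' ?] ?] /= [[? ? ? ?] _].
have fm k : [/\ Ns (m k.+1), N `<=` m k.+1, m k.+1 <> N & m k.+1 `<=` m k] /\
    [/\ m k (x k), m k (z k), forall v, m k.+1 v -> ip (x k) v = 0 &
        forall v, m k.+1 v -> ip (z k) v = 0] /\
    [/\ rnorm (x k) = 1, rnorm (z k) <= d^-1 & ip (T (x k)) (z k) = 1].
  have := fP _ (gm k); rewrite /x /z /m iterS -/(m k).
  by case: (f (m k)) => [[M' ?] ?].
have mono j k : (j <= k)%N -> m k `<=` m j.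
  elim: k => [|k IH]; first by rewrite leqn0 => /eqP ->.
  rewrite leq_eqVlt => /predU1P[->//|/IH jk]; apply: subset_trans jk.
  by have [[_ _ _]] := fm k.
have Nm k : Ns (m k) by case: (gm k).
have mx j k : (j < k)%N -> m j.+1 (x k).
  by move=> jk; apply: mono jk _ _; have [_ [[]]] := fm k.
have mz j k : (j < k)%N -> m j.+1 (z k).
  by move=> jk; apply: mono jk _ _; have [_ [[]]] := fm k.
have xp k v : m k.+1 v -> ip (x k) v = 0 by have [_ [[_ _ h _] _]] := fm k; exact: h.
have zp k v : m k.+1 v -> ip (z k) v = 0 by have [_ [[_ _ _ h] _]] := fm k; exact: h.
exists x, z; split; first by rewrite invr_gt0.
- by move=> k; have [_ [_ []]] := fm k.
- by move=> k; have [_ [_ []]] := fm k.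
- move=> j k; case: ltngtP => // jk _; first by apply: xp; exact: mx.
  by apply: ip_eq0C; apply: xp; exact: mx.
- move=> j k; case: ltngtP => // jk _; first by apply: zp; exact: mz.
  by apply: ip_eq0C; apply: zp; exact: mz.
- by move=> k; have [_ [_ []]] := fm k.
- move=> j k jk; apply: (alg_rank_one Ns_nest (Nm k.+1) (Nm k.+1)).
  + by move=> L NL; exact: (nest_total Ns_nest).
  + exact: mx.
  + by move=> v mv; apply: ip_eq0C; exact: zp.
- move=> j k jk; apply: ip_eq0C; apply: zp; apply: ATP => //; exact: mx.
Qed.

End Approximation.

(** * The Jacobson radical and compact elements, locally *)

Section JacobsonRadical.
Variables (R : realType) (H : normedModType R[i]).
Implicit Types (A I J M : set (bop H)) (S T B : bop H).

Lemma proper_left_ideal_sub_maximal A I : A 1 -> left_ideal A I -> ~ I 1 ->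
  exists2 M, maximal_left_ideal A M & I `<=` M.
Proof.
move=> A1 lI I1; pose good J := left_ideal A J /\ I `<=` J /\ ~ J 1.
pose Q J := J = set0 \/ good J.
have [F FQ totF|M [QM maxM]] := @Zorn_bigcup _ Q.
  have [[J0 [FJ0 gJ0]]|nF] := pselect (exists J, F J /\ good J); last first.
    left; apply/seteqP; split=> // x [J FJ Jx]; have [J0|gJ] := FQ _ FJ.
      by rewrite J0 in Jx.
    by exfalso; apply: nF; exists J.
  right; pose F' := [set J | F J /\ good J].
  have -> : \bigcup_(J in F) J = \bigcup_(J in F') J.
    apply/seteqP; split=> x [J FJ Jx]; last by exists J => //; case: FJ.
    exists J => //; split=> //; have [J0'|//] := FQ _ FJ.
    by rewrite J0' in Jx.
  split; first split.
  - by move=> x [J [_ [[JA _ _] _]] Jx]; exact: JA.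
  - apply: chain_union_subspace; first by exists J0.
      by move=> J [_ [[_ ? _] _]].
    by move=> J K [FJ _] [FK _]; exact: totF.
  - move=> a x Aa [J FJ Jx]; exists J => //.
    by case: FJ => _ [[_ _ Jl] _]; exact: Jl.
  split.
    by move=> x Ix; exists J0 => //; case: gJ0 => _ [IJ0 _]; exact: IJ0.
  by case=> J [_ [_ [_ J1]]].
have I0 : I 0 by case: lI => _ [].
have gM : good M.
  case: QM => // M0; exfalso; apply: (maxM I); last by right; split=> //; split.
  by rewrite M0; split=> // h; exact: (h 0).
case: gM => lM [IM M1]; exists M => //; split=> //.
  by move=> MA; apply: M1; rewrite MA.
move=> J lJ MJ; have [J1|J1] := pselect (J 1).
  right; have [JA _ Jl] := lJ; apply/seteqP; split=> // x Ax.
  by rewrite -[x]mulr1; exact: Jl.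
left; apply: contrapT => JM; apply: (maxM J).
  by split=> // JM'; apply: JM; exact/seteqP.
by right; split=> //; split=> //; exact: subset_trans MJ.
Qed.

Section Algebra.
Variable A : set (bop H).
Hypotheses (sA : linear_subspace A) (A1 : A 1) (AM : forall S T, A S -> A T -> A (S * T)).

Let AB S T : A S -> A T -> A (S - T). Proof. exact: subspaceB. Qed.

(** Otherwise the left ideal generated by [1 - S * T] lies in a maximal one, which contains [S * T]
    as well and hence 1. *)
Lemma jacobson_radical_left_inv T S : jacobson_radical A T -> A S ->
  exists2 B, A B & B * (1 - S * T) = 1.
Proof.
move=> [AT radT] AS; have A1ST : A (1 - S * T) by apply: AB => //; exact: AM.
have [A0 AD AZ] := sA.
pose I := [set B * (1 - S * T) | B in A].
have lI : left_ideal A I.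
  split; [by move=> _ [B AB' <-]; exact: AM| |].
  - split; first by exists 0 => //; rewrite mul0r.
      by move=> _ _ [B AB1 <-] [B' AB2 <-]; exists (B + B'); [exact: AD|rewrite mulrDl].
    by move=> c _ [B AB1 <-]; exists (c *: B); [exact: AZ|apply: bopP].
  - by move=> a _ Aa [B AB1 <-]; exists (a * B); [exact: AM|rewrite mulrA].
have [[B ABB BE]|nI1] := pselect (I 1); first by exists B.
have [M mM IM] := proper_left_ideal_sub_maximal A1 lI nI1.
have [[MA sM Ml] MnA _] := mM; exfalso; apply: MnA; apply/seteqP; split=> // x Ax.
have M1 : M 1.
  have -> : (1 : bop H) = (1 - S * T) + S * T by rewrite subrK.
  have [_ MD _] := sM; apply: MD.
    by apply: IM; exists 1 => //; rewrite mul1r.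
  by apply: Ml => //; exact: radT.
by rewrite -[x]mulr1; exact: Ml.
Qed.

(** If a maximal left ideal [M] omitted [T], then [M] and [T] would generate 1, say [1 = m + S * T];
    but [m = 1 - S * T] is left invertible, so [M] would contain 1. *)
Lemma left_inv_jacobson_radical T : A T ->
  (forall S, A S -> exists2 B, A B & B * (1 - S * T) = 1) -> jacobson_radical A T.
Proof.
move=> AT invT; split=> // M mM; have [[MA sM Ml] MnA Mmax] := mM.
have [A0 AD AZ] := sA; have [M0 MD MZ] := sM.
pose J := [set m + S * T | m in M & S in A].
have lJ : left_ideal A J.
  split.
  - by move=> _ [m Mm [S AS <-]]; apply: AD; [exact: MA|exact: AM].
  - split; first by exists 0 => //; exists 0 => //; rewrite mul0r addr0.
      move=> _ _ [m Mm [S AS <-]] [m' Mm' [S' AS' <-]].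
      exists (m + m'); first exact: MD.
      by exists (S + S'); [exact: AD|rewrite mulrDl addrACA].
    move=> c _ [m Mm [S AS <-]]; exists (c *: m); first exact: MZ.
    by exists (c *: S); [exact: AZ|apply: bopP => x; rewrite scalerDr].
  - move=> a _ Aa [m Mm [S AS <-]]; exists (a * m); first exact: Ml.
    by exists (a * S); [exact: AM|rewrite mulrDr mulrA].
have MJ : M `<=` J.
  by move=> m Mm; exists m => //; exists 0 => //; rewrite mul0r addr0.
have JT : J T by exists 0 => //; exists 1 => //; rewrite mul1r add0r.
have [<-//|JA] := Mmax _ lJ MJ.
have [m Mm [S AS mS]] : J 1 by rewrite JA.
exfalso; apply: MnA; apply/seteqP; split=> // x Ax.
have [B AB1 BE] := invT _ AS.
have M1 : M 1.
  by rewrite -BE -mS addrK; exact: Ml.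
by rewrite -[x]mulr1; exact: Ml.
Qed.

End Algebra.
End JacobsonRadical.

(** * Compact elements and the radical at gaps and limit points *)

Section LocalBounds.
Variables (R : realType) (H : completeNormedModType R[i]).
Variables (ip : {dot H for Num.conj}) (ip_norm : forall x : H, ip x x = `|x| ^+ 2).
Variables (Ns : set (set H)) (Ns_nest : nest Ns).
Implicit Types (x y z v w : H) (M N L : set H) (S T : bop H).

Local Notation A := (nest_alg Ns).
Local Notation P := (nproj ip_norm).
Local Notation E := (nint ip_norm).
Local Notation compr := (compr ip_norm).

Definition nest_gap M N := forall L, Ns L -> N `<=` L \/ L `<=` M.

(** The closed span of the strictly smaller members belongs to the nest: it is [N] or its immediate
    predecessor. *)
Lemma left_limit_or_gap N : Ns N ->
  left_limit Ns N \/ exists M, [/\ Ns M, M `<=` N, M <> N & nest_gap M N].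
Proof.
move=> NN; rewrite /left_limit; set F := [set M | _].
have FN : F `<=` Ns by move=> M [].
set M := closed_span _.
have NM : Ns M by exact: nest_closed_span.
have MN : M `<=` N.
  apply: closed_span_sub; [exact: (nest_subspace Ns_nest NN)|exact: (nest_closed Ns_nest NN)|].
  by move=> x [L [_ LN _]]; exact: LN.
have [->|MnN] := pselect (N = M); [by left|right; exists M; split=> //; first exact: nesym].
move=> L NL; have [NsL|LN] := nest_total Ns_nest NN NL; first by left.
have [->|LnN] := pselect (L = N); first by left.
by right=> x Lx; apply: sub_closed_span; exists L.
Qed.

Lemma right_limit_or_gap N : Ns N ->
  right_limit Ns N \/ exists M, [/\ Ns M, N `<=` M, M <> N & nest_gap N M].
Proof.
move=> NN; rewrite /right_limit; set F := [set M | _].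
have FN : F `<=` Ns by move=> M [].
set M := \bigcap_(M in F) M.
have NM : Ns M by exact: nest_bigcap.
have NM' : N `<=` M by move=> x Nx L [_ NL _]; exact: NL.
have [->|MnN] := pselect (N = M); [by left|right; exists M; split=> //; first exact: nesym].
move=> L NL; have [NsL|LN] := nest_total Ns_nest NN NL; last by right.
have [->|LnN] := pselect (L = N); first by right.
by left=> x Mx; exact: Mx.
Qed.

(** The common frame for compact elements and radical elements: gaps are handled by hypothesis, and
    failure at a limit point would produce a block sequence. *)
Lemma nest_locally_of_no_blocks T (d : R) (Q : set H -> set H -> Prop) : A T -> 0 < d ->
  (forall up C (x z : nat -> H), ~ block_seq ip_norm Ns up T C x z) ->
  (forall M N, Ns M -> Ns N -> M `<=` N -> nest_gap M N -> Q M N) ->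
  (forall M N, Ns M -> Ns N -> M `<=` N -> rnorm (compr M N T) <= d -> Q M N) ->
  nest_locally Ns Q.
Proof.
move=> AT d0 nob Qgap Qsmall; split=> N NN N0.
- have [limN|[M [NM MN MnN gMN]]] := left_limit_or_gap NN; last first.
    by exists M; split=> //; exact: Qgap.
  apply: contrapT => nM.
  have [x [z]] : exists x z : nat -> H, block_seq ip_norm Ns true T d^-1 x z; last exact: nob.
  apply: (left_limit_block_seq Ns_nest AT NN N0 limN d0) => M NM MN MnN.
  rewrite ltNge; apply/negP => h; apply: nM; exists M; split=> //; exact: Qsmall.
- have [limN|[M [NM MN MnN gMN]]] := right_limit_or_gap NN; last first.
    by exists M; split=> //; exact: Qgap.
  apply: contrapT => nM.
  have [x [z]] : exists x z : nat -> H, block_seq ip_norm Ns false T d^-1 x z; last exact: nob.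
  apply: (right_limit_block_seq Ns_nest AT NN N0 limN d0) => M NM MN MnN.
  rewrite ltNge; apply/negP => h; apply: nM; exists M; split=> //; exact: Qsmall.
Qed.

(** On a gap the compression of the algebra is all of [B(N - M)]: the vectors
    found here make [rank_one u w] a member of it for every [u] in [N]. *)
Lemma gap_vectors M N T : A T -> Ns M -> Ns N -> M `<=` N -> compr M N T <> 0 ->
  exists v w, [/\ E M N v = v, w <> 0, N w, forall m, M m -> ip m w = 0 &
    ip (T v) w = (rnorm w ^+ 2)%:C].
Proof.
move=> /nest_algP AT NM NN MN cT0.
have [v cTv] : exists v, compr M N T v <> 0.
  apply: contrapT => nv; apply: cT0; apply: bopP => v; apply: contrapT => h.
  by apply: nv; exists v.
have Nint u : N (E M N u).
  by rewrite -(nint_projl ip_norm Ns_nest NM NN MN) bopME; exact: (nproj_in ip_norm Ns_nest NN).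
exists (E M N v), (compr M N T v); split=> //.
- by rewrite -bopME (nint_idem ip_norm Ns_nest).
- exact: Nint.
- move=> m Mm; apply: ip_eq0C; rewrite /compr !bopME (nint_app ip_norm Ns_nest NM NN MN).
  exact: (nproj_ortho ip_norm Ns_nest NM).
rewrite -(ipxx ip_norm); set w := compr M N T v; set u := T (E M N v).
have wE : w = u - P M u.
  rewrite /w /compr !bopME (nint_app ip_norm Ns_nest NM NN MN) -/u.
  by rewrite (nproj_id ip_norm Ns_nest NN)//; apply: AT.
have -> : u = w + P M u by rewrite wE subrK.
rewrite ipDl [ip (P M u) w]ip_eq0C ?addr0// wE.
apply: (nproj_ortho ip_norm Ns_nest NM); exact: (nproj_in ip_norm Ns_nest NM).
Qed.

Lemma compact_element_totally_bounded T : compact_elements A T ->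
  totally_bounded [set T * s * T | s in A `&` @unit_ball R (bop H)].
Proof.
by move=> [_] /(compact_map_onP (@complete_rcomplete _ _)).
Qed.

(** With [s] the rank one operator built from [E M N u] and [w], scaled into the unit ball,
    evaluating [T * s * T] at [v] recovers [compr M N T u] up to a constant. The image of the unit
    ball is thus inside a Lipschitz image of a totally bounded set. *)
Lemma compact_element_gap M N T : compact_elements A T -> Ns M -> Ns N -> M `<=` N ->
  nest_gap M N -> compact_op (compr M N T).
Proof.
move=> cT NM NN MN gMN; have [AT _] := cT.
have [->|cT0] := pselect (compr M N T = 0); first exact: compact_op0.
have [v [w [Ev w0 Nw Mw Tvw]]] := gap_vectors AT NM NN MN cT0.
have nw : 0 < rnorm w by rewrite rnorm_gt0; exact/eqP.
have nw' : 0 <= (rnorm w)^-1 by rewrite invr_ge0 ltW.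
have tb := compact_element_totally_bounded cT.
have lip (X Y : bop H) : rnorm ((rnorm w)^-1%:C *: E M N (X v) - (rnorm w)^-1%:C *: E M N (Y v)) <=
    (rnorm w)^-1 * rnorm v * rnorm (X - Y).
  rewrite -scalerBr -linearB rnormZ rnorm_real ger0_norm// -mulrA ler_wpM2l//.
  apply: le_trans (rnorm_nint_app ip_norm Ns_nest NM NN MN _) _.
  by rewrite -bopBE mulrC rnorm_app.
apply: totally_bounded_subset (totally_bounded_image (fun X Y _ _ => lip X Y) tb).
move=> _ [u u1 <-].
pose s : bop H := (rnorm w)^-1%:C *: rank_one ip_norm (E M N u) w.
exists (T * s * T).
  exists s => //; split.
    apply: algZ => //; apply: (alg_rank_one Ns_nest NM NN gMN) => //.
    by rewrite -(nint_projl ip_norm Ns_nest NM NN MN) bopME; exact: (nproj_in ip_norm Ns_nest NN).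
  rewrite /unit_ball /= /s rnormZ rnorm_real ger0_norm// ler_pdivrMl// mulr1.
  apply: le_trans (rnorm_rank_one _ _ _) _; rewrite ler_piMl ?rnorm_ge0//.
  by apply: le_trans (rnorm_nint_app ip_norm Ns_nest NM NN MN _) u1.
rewrite /compr !bopME /s bopZE rank_oneE Tvw; move: (E M N) => e.
rewrite !linearZ /= !scalerA -!rmorphM /= [X in X%:C *: _](_ : _ = 1) ?scale1r//.
by field; rewrite gt_eqF.
Qed.

(** Otherwise a rank one [S] in the algebra satisfies [S (T v) = v] with [v] nonzero, and
    [1 - S * T] has no left inverse. *)
Lemma radical_gap M N T : jacobson_radical A T -> Ns M -> Ns N -> M `<=` N ->
  nest_gap M N -> compr M N T = 0.
Proof.
move=> radT NM NN MN gMN; have [AT _] := radT; apply: contrapT => cT0.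
have [v [w [Ev w0 Nw Mw Tvw]]] := gap_vectors AT NM NN MN cT0.
have nw : 0 < rnorm w by rewrite rnorm_gt0; exact/eqP.
have Nv : N v.
  by rewrite -Ev -(nint_projl ip_norm Ns_nest NM NN MN) bopME; exact: (nproj_in ip_norm Ns_nest NN).
pose S : bop H := (rnorm w ^- 2)%:C *: rank_one ip_norm v w.
have AS : A S by apply: algZ => //; exact: (alg_rank_one Ns_nest NM NN gMN).
have [B _ BE] := jacobson_radical_left_inv (alg_subspace Ns_nest) (@alg1 _ _ Ns)
  (@algM _ _ Ns) radT AS.
have STv : (S * T) v = v.
  rewrite bopME /S bopZE rank_oneE Tvw scalerA -rmorphM /= mulVf ?scale1r//.
  by rewrite expf_eq0 gt_eqF.
have v0 : v = 0.
  have : (B * (1 - S * T)) v = 0 by rewrite bopME bopBE STv subrr linear0.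
  by rewrite BE.
have : rnorm w ^+ 2 = 0.
  by apply: (@complexI R); rewrite -Tvw v0 linear0 ip0l.
by move/eqP; rewrite expf_eq0 gt_eqF.
Qed.

Lemma radical_locally_small T (e : R) : jacobson_radical A T -> 0 < e ->
  nest_locally Ns (small ip_norm T e).
Proof.
move=> radT e0; have [AT _] := radT.
apply: (nest_locally_of_no_blocks AT e0) => //.
- move=> up C x z /(block_seq_not_left_invertible Ns_nest AT)[S AS nB].
  have [B _ BE] := jacobson_radical_left_inv (alg_subspace Ns_nest) (@alg1 _ _ Ns)
    (@algM _ _ Ns) radT AS.
  exact: nB BE.
- by move=> M N NM NN MN gMN; rewrite /small radical_gap// rnorm0 ltW.
Qed.

End LocalBounds.

(** * The ideal generated by the compact elements *)

Section BlockDecomposition.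
Variables (R : realType) (H : completeNormedModType R[i]).
Variables (ip : {dot H for Num.conj}) (ip_norm : forall x : H, ip x x = `|x| ^+ 2).
Variables (Ns : set (set H)) (Ns_nest : nest Ns).
Implicit Types (x y z v w : H) (M N L : set H) (S T X D K : bop H).

Local Notation A := (nest_alg Ns).
Local Notation P := (nproj ip_norm).
Local Notation E := (nint ip_norm).
Local Notation compr := (compr ip_norm).
Local Notation nest_chain := (nest_chain Ns).
Local Notation nest_locally := (nest_locally Ns).
Local Notation small := (small ip_norm).

Lemma upper_triangular M N X : A X -> Ns M -> Ns N -> M `<=` N -> E M N * X * P M = 0.
Proof.
move=> AX NM NN MN.
rewrite -mulrA -(nproj_alg_comp ip_norm Ns_nest NM AX) !mulrA.
by rewrite (nint_proj0r ip_norm Ns_nest NM NN MN) !mul0r.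
Qed.

Lemma block_decomposition N L X : A X -> Ns N -> Ns L -> N `<=` L ->
  P L * X * P L = P N * X * P N + P N * X * E N L + compr N L X.
Proof.
move=> AX NN NL NsL; have := upper_triangular AX NN NL NsL; rewrite /compr.
have -> : P L = P N + E N L by rewrite /nint addrC subrK.
move: (E N L) => e eX0.
by rewrite !(mulrDl, mulrDr) eX0 addr0 addrA.
Qed.

Lemma compr_later M N N' L X : Ns M -> Ns N -> Ns N' -> Ns L ->
  M `<=` N' -> N' `<=` N -> N `<=` L -> compr M N' (compr N L X) = 0.
Proof.
move=> NM NN NN' NL MN' NN1 NsL; rewrite /compr.
have e0 : E M N' * E N L = 0.
  rewrite -(nint_projr ip_norm Ns_nest NM NN' MN') -mulrA.
  rewrite -[P N'](nproj_mulr ip_norm Ns_nest NN' NN NN1) -!mulrA.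
  by rewrite (nint_proj0l ip_norm Ns_nest NN NL NsL) !mulr0.
by rewrite !mulrA e0 !mul0r.
Qed.

Lemma compr_earlier N L X : Ns N -> Ns L -> N `<=` L -> P N * X = X -> compr N L X = 0.
Proof.
move=> NN NL NsL <-; rewrite /compr !mulrA.
by rewrite (nint_proj0r ip_norm Ns_nest NN NL NsL) !mul0r.
Qed.

(** Choices made on separate cells add up to one block diagonal operator. The blocks have orthogonal
    initial spaces and orthogonal ranges, so by Pythagoras the common bound [c] survives;
    [P L * K = K] keeps the cells above [L] untouched. [W] records what each block was chosen
    for. *)
Lemma glue_blocks (C : set (bop H)) (c : R) (W : set H -> set H -> bop H -> Prop) L :
  C 0 -> (forall S T, C S -> C T -> C (S + T)) ->
  (forall M N T, Ns M -> Ns N -> M `<=` N -> C T -> C (compr M N T)) -> 0 <= c ->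
  nest_chain (fun M N => exists K, [/\ C K, rnorm (compr M N K) <= c & W M N (compr M N K)]) L ->
  exists K, [/\ C K, forall v, rnorm (K v) <= c * rnorm (P L v), P L * K = K &
    nest_chain (fun M N => W M N (compr M N K)) L].
Proof.
move=> C0 CD CE c0; elim=> [|N L' cN [K [CK Kc PK WK]] NL NsL [K' [CK' K'c WK']]].
  exists 0; split=> //; [|by rewrite mulr0|exact: NestChain0].
  by move=> v; rewrite bop0E rnorm0 mulr_ge0 ?rnorm_ge0.
have NN := nest_chain_in Ns_nest cN.
have [D DE] : exists D, D = compr N L' K' by exists (compr N L' K').
have DEv v : D (E N L' v) = D v.
  have DEE : D * E N L' = D.
    by rewrite DE /compr -[LHS]mulrA (nint_idem ip_norm Ns_nest NN NL NsL).
  by rewrite -[in RHS]DEE bopME.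
have PLD : P L' * D = D.
  by rewrite DE /compr !mulrA (nint_projl ip_norm Ns_nest NN NL NsL).
have PND v : P N (D v) = 0.
  have PND0 : P N * D = 0.
    by rewrite DE /compr !mulrA (nint_proj0l ip_norm Ns_nest NN NL NsL) !mul0r.
  by rewrite -bopME PND0 bop0E.
have KD0 v : ip (K v) (D v) = 0.
  apply: ip_eq0C; rewrite -PK bopME.
  have := nproj_ortho ip_norm Ns_nest NN (D v) (nproj_in ip_norm Ns_nest NN (K v)).
  by rewrite PND subr0.
exists (K + D); split.
- by apply: CD => //; rewrite DE; exact: CE.
- move=> v; rewrite -(@ler_pXn2r _ 2)// ?nnegrE ?mulr_ge0 ?rnorm_ge0//.
  rewrite bopDE (pythagoras ip_norm (KD0 v)) exprMn.
  rewrite (nproj_nint_sqr ip_norm Ns_nest NN NL NsL) mulrDr -!exprMn.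
  apply: lerD; rewrite ler_pXn2r ?nnegrE ?mulr_ge0 ?rnorm_ge0//.
  rewrite -DEv; apply: le_trans (rnorm_app _ _) _.
  by rewrite DE ler_wpM2r ?rnorm_ge0.
- by rewrite mulrDr PLD -PK mulrA (nproj_mull ip_norm Ns_nest NN NL NsL).
apply: (NestChainS (N := N)) => //; last first.
  rewrite comprD (compr_earlier NN NL NsL PK) add0r DE.
  by rewrite -(compr_sub ip_norm Ns_nest K' NN NL NN NL).
apply: (nest_chain_mono Ns_nest _ WK) => M N' NM NN' MN' NN1.
by rewrite comprD DE (compr_later K' NM NN NN' NL MN' NN1 NsL) addr0.
Qed.

(** The Neumann series, whose sum stays in the algebra because the algebra is norm closed. *)
Lemma neumann_left_inv D : A D -> rnorm D <= 2^-1 -> exists2 Y, A Y & Y * (1 - D) = 1.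
Proof.
move=> AD D2; have h0 : (0 : R) <= 2^-1 by lra.
have Dn n : rnorm (D ^+ n) <= 2^-1 ^+ n.
  elim: n => [|n IH]; first by apply: rnorm_bop => // x; rewrite !expr0 bop1E mul1r.
  by rewrite !exprS; apply: le_trans (rnorm_comp _ _) _; rewrite ler_pM ?rnorm_ge0.
pose Y n := \sum_(0 <= k < n) D ^+ k.
have AY n : A (Y n).
  apply: subspace_sum; first exact: alg_subspace.
  move=> k _; elim: k => [|k IH]; first exact: alg1.
  by rewrite exprS; exact: algM.
have [|l [Yl _]] := @geom_rcvg _ _ Y 1 (bop_rcomplete (@complete_rcomplete _ H)).
  by move=> n; rewrite /Y big_nat_recr// addrC addrA addNr add0r mul1r.
have YD n : Y n * (1 - D) = 1 - D ^+ n.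
  elim: n => [|n IH]; first by rewrite /Y big_nil mul0r expr0 subrr.
  rewrite /Y big_nat_recr// mulrDl -/(Y n) IH mulrBr mulr1 -exprSr.
  by rewrite addrA subrK.
exists l; first exact: rcvg_closed (nest_alg_closed Ns_nest) AY Yl.
apply: (@rcvg_unique _ _ (fun n => Y n * (1 - D))) => e e0.
  have d0 : 0 < rnorm (1 - D) + 1 by rewrite ltr_wpDl ?rnorm_ge0.
  have [N YN] := Yl _ (divr_gt0 e0 d0); exists N => n /YN.
  rewrite -mulrBl ltr_pdivlMr//; apply: le_lt_trans.
  by apply: le_trans (rnorm_comp _ _) _; rewrite ler_wpM2l ?rnorm_ge0// lerDl.
have [N NP] := half_pow_lt e0.
exists N => n /NP ne; rewrite YD addrC addrA addNr add0r rnormN.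
exact: le_lt_trans (Dn n) ne.
Qed.

(** Adding a cell factors the new operator as [(1 - c) * (1 - u) * (1 - p)], with [c] the diagonal
    block, [u] the off-diagonal corner and [p] the old part. The factors are inverted on the left by
    a Neumann series, by [1 + u] since [u * u = 0], and by induction. *)
Lemma chain_left_inv X L : A X -> nest_chain (small X 2^-1) L ->
  exists2 B, A B & B * (1 - P L * X * P L) = 1.
Proof.
move=> AX; elim=> [|N L' cN [B AB BX] NL NsL sX].
  by exists 1; [exact: alg1|rewrite (nproj0 ip_norm Ns_nest) !mul0r subr0 mul1r].
have NN := nest_chain_in Ns_nest cN.
have [Y AY YD] := neumann_left_inv (alg_compr Ns_nest NN NL AX) sX.
pose U := P N * X * E N L'.
have PE : E N L' * P N = 0 := nint_proj0r ip_norm Ns_nest NN NL NsL.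
have AU : A U.
  apply: algM; last exact: alg_nint.
  by apply: algM => //; exact: alg_nproj.
exists (B * (1 + U) * Y).
  by apply: algM => //; apply: algM => //; apply: algD => //; exact: alg1.
have UP : U * (P N * X * P N) = 0.
  by rewrite /U -!mulrA (mulrA (E N L') (P N)) PE !(mul0r, mulr0).
have CU : compr N L' X * U = 0.
  by rewrite /U /compr -!mulrA (mulrA (E N L') (P N)) PE !(mul0r, mulr0).
have CP : compr N L' X * (P N * X * P N) = 0.
  by rewrite /compr -!mulrA (mulrA (E N L') (P N)) PE !(mul0r, mulr0).
have UU : U * U = 0.
  by rewrite /U -!mulrA (mulrA (E N L') (P N)) PE !(mul0r, mulr0).
have -> : 1 - P L' * X * P L' =
    (1 - compr N L' X) * ((1 - U) * (1 - P N * X * P N)).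
  rewrite (block_decomposition AX NN NL NsL) -/U.
  move: (compr N L' X) (P N * X * P N) U CU CP UP {UU AU YD sX PE BX} => c p u cu cp up.
  rewrite (mulrBl (1 - p)) mul1r (mulrBr u) mulr1 up subr0.
  rewrite mulrBl mul1r !(mulrBr c) mulr1 cp cu !subr0.
  by rewrite !opprD !addrA.
have UinvU : (1 + U) * (1 - U) = 1.
  by rewrite mulrDl mul1r mulrBr mulr1 UU subr0 subrK.
by rewrite mulrA -(mulrA (B * _)) YD mulr1 mulrA -(mulrA B) UinvU mulr1.
Qed.

Lemma locally_small_radical T : A T ->
  (forall e : R, 0 < e -> nest_locally (small T e)) -> jacobson_radical A T.
Proof.
move=> AT Tsmall; apply: (left_inv_jacobson_radical (alg_subspace Ns_nest) (@alg1 _ _ Ns)) => //.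
  exact: algM.
move=> S AS; have AST := algM AS AT.
have s0 : 0 < 2 * (rnorm S + 1) by rewrite mulr_gt0// ltr_wpDl ?rnorm_ge0.
have sST : nest_locally (small (S * T) 2^-1).
  have si0 : 0 < (2 * (rnorm S + 1))^-1 by rewrite invr_gt0.
  apply: (nest_locally_mono _ (Tsmall _ si0)) => M N NM NN MN; rewrite /small => sT.
  rewrite (comprM ip_norm Ns_nest NM NN MN AS AT); apply: le_trans (rnorm_comp _ _) _.
  apply: (@le_trans _ _ ((rnorm S + 1) * (2 * (rnorm S + 1))^-1)).
    apply: ler_pM; rewrite ?rnorm_ge0//.
    by apply: le_trans (rnorm_compr ip_norm Ns_nest NM NN MN _) _; rewrite lerDl.
  by rewrite invfM mulrCA divff ?mulr1// gt_eqF// ltr_wpDl ?rnorm_ge0.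
have [B AB BE] := chain_left_inv AST (nest_locally_chain Ns_nest
  (@small_hereditary _ _ _ ip_norm _ Ns_nest _ _) sST).
by exists B => //; move: BE; rewrite (nprojT ip_norm Ns_nest) mul1r mulr1.
Qed.

(** * The ideal of operators locally close to compact ones *)

Definition alg_compact : set (bop H) := [set T | A T /\ compact_op T].

Lemma alg_compact0 : alg_compact 0.
Proof. by split; [exact: alg0|exact: compact_op0]. Qed.

Lemma alg_compactD S T : alg_compact S -> alg_compact T -> alg_compact (S + T).
Proof. by move=> [AS cS] [AT cT]; split; [exact: algD|exact: compact_opD]. Qed.

Lemma alg_compactB S T : alg_compact S -> alg_compact T -> alg_compact (S - T).
Proof. by move=> [AS cS] [AT cT]; split; [exact: algB|exact: compact_opB]. Qed.

Lemma alg_compactMl S T : A S -> alg_compact T -> alg_compact (S * T).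
Proof. by move=> AS [AT cT]; split; [exact: algM|exact: compact_op_compl]. Qed.

Lemma alg_compactMr S T : A S -> alg_compact T -> alg_compact (T * S).
Proof. by move=> AS [AT cT]; split; [exact: algM|exact: compact_op_compr]. Qed.

Lemma alg_compact_compr M N T : Ns M -> Ns N -> M `<=` N ->
  alg_compact T -> alg_compact (compr M N T).
Proof.
move=> NM NN MN cT; have AE : A (E M N) by exact: alg_nint.
by apply: alg_compactMr => //; exact: alg_compactMl.
Qed.

Lemma nest_compactE : nest_compact Ns = alg_compact.
Proof.
by apply/seteqP; split=> T [AT /(compact_opP (@complete_rcomplete _ H)) cT].
Qed.

(** An intrinsic description of [K(N) + Rad(N)], from which it is plain that
    this set is closed. *)
Definition locally_compact_ideal : set (bop H) := [set T | A T /\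
  forall e : R, 0 < e -> exists2 K, alg_compact K & nest_locally (small (T - K) e)].

Lemma compact_element_locally T : compact_elements A T -> locally_compact_ideal T.
Proof.
move=> cT; have [AT _] := cT; split=> // e e0.
(* The approximant may depend on the interval: the compression of [T] at a gap, 0 near a limit
   point. The bound by [rnorm T], common to all cells, is what gluing requires. *)
pose Q M N := exists K, [/\ alg_compact K, rnorm (compr M N K) <= rnorm T &
  rnorm (compr M N T - compr M N K) <= e].
have hQ : hereditary Ns Q.
  move=> M N M' N' NM NN NM' NN' MM' MN' NN1 [K [cK KT TK]].
  have cs X : compr M' N' X = compr M' N' (compr M N X) by exact: (compr_sub _ Ns_nest).
  exists K; split=> //; first by rewrite cs; exact: le_trans (rnorm_compr ip_norm Ns_nest NM' NN' MN' _) KT.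
  by rewrite (cs T) (cs K) -comprB; exact: le_trans (rnorm_compr ip_norm Ns_nest NM' NN' MN' _) TK.
have lQ : nest_locally Q.
  apply: (nest_locally_of_no_blocks (ip_norm := ip_norm) Ns_nest AT e0).
  - move=> up C x z /(block_seq_not_compact Ns_nest AT); apply.
    exact: compact_element_totally_bounded.
  - move=> M N NM NN MN gMN; exists (compr M N T); split.
    + split; first exact: (alg_compr Ns_nest).
      exact: (compact_element_gap ip_norm Ns_nest cT).
    + apply: le_trans (rnorm_compr _ Ns_nest NM NN MN _) _.
      exact: (rnorm_compr _ Ns_nest NM NN MN).
    + by rewrite -(compr_sub ip_norm Ns_nest T NM NN NM NN)// subrr rnorm0 ltW.
  - move=> M N NM NN MN Te; exists 0; split; first exact: alg_compact0.
      by rewrite compr0 rnorm0 rnorm_ge0.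
    by rewrite compr0 subr0.
have cQ := nest_locally_chain Ns_nest hQ lQ.
have [K [cK _ _ chK]] := glue_blocks alg_compact0 alg_compactD alg_compact_compr
  (rnorm_ge0 _) (W := fun M N X => rnorm (compr M N T - X) <= e) cQ.
exists K => //; apply: (nest_chain_locally Ns_nest); first exact: (@small_hereditary _ _ _ ip_norm _ Ns_nest).
by apply: (nest_chain_mono Ns_nest _ chK) => M N NM NN MN _; rewrite /small comprB.
Qed.

Lemma small_mul S T e : A S -> A T -> 0 < e ->
  nest_locally (small T (e / (rnorm S + 1))) ->
  nest_locally (small (S * T) e) /\ nest_locally (small (T * S) e).
Proof.
move=> AS AT e0 sT; have s0 : 0 < rnorm S + 1 by rewrite ltr_wpDl ?rnorm_ge0.
have eE : (rnorm S + 1) * (e / (rnorm S + 1)) = e by field; rewrite gt_eqF.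
split; apply: (nest_locally_mono _ sT) => M N NM NN MN; rewrite /small => h.
  rewrite (comprM ip_norm Ns_nest NM NN MN AS AT) -eE; apply: le_trans (rnorm_comp _ _) _.
  apply: ler_pM; rewrite ?rnorm_ge0//.
  by apply: le_trans (rnorm_compr ip_norm Ns_nest NM NN MN _) _; rewrite lerDl.
have eE' : (e / (rnorm S + 1)) * (rnorm S + 1) = e by rewrite divfK// gt_eqF.
rewrite (comprM ip_norm Ns_nest NM NN MN AT AS) -eE'; apply: le_trans (rnorm_comp _ _) _.
apply: ler_pM; rewrite ?rnorm_ge0//.
by apply: le_trans (rnorm_compr ip_norm Ns_nest NM NN MN _) _; rewrite lerDl.
Qed.

Lemma small_add S T e : 0 < e -> nest_locally (small S (e / 2)) ->
  nest_locally (small T (e / 2)) -> nest_locally (small (S + T) e).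
Proof.
move=> e0 sS sT.
have hS := @small_hereditary _ _ _ ip_norm _ Ns_nest S (e / 2).
have hT := @small_hereditary _ _ _ ip_norm _ Ns_nest T (e / 2).
apply: nest_locally_mono (nest_locallyI Ns_nest hS hT sS sT) => M N NM NN MN [].
by rewrite /small comprD; have := rnormD (compr M N S) (compr M N T); lra.
Qed.

Lemma locally_compact_two_sided : two_sided_ideal A locally_compact_ideal.
Proof.
have ideal_mul S T : A S -> locally_compact_ideal T ->
    locally_compact_ideal (S * T) /\ locally_compact_ideal (T * S).
  move=> AS [AT cT]; have s0 : 0 < rnorm S + 1 by rewrite ltr_wpDl ?rnorm_ge0.
  have approx e : 0 < e -> exists2 K, alg_compact K &
      nest_locally (small (S * T - S * K) e) /\ nest_locally (small (T * S - K * S) e).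
    move=> e0; have [K cK TK] := cT _ (divr_gt0 e0 s0); exists K => //.
    have [AK _] := cK; rewrite -(mulrBr S T K) -(mulrBl S T K).
    exact: (small_mul AS (algB Ns_nest AT AK) e0 TK).
  split; (split; first exact: algM) => e /approx[K cK [h1 h2]].
    by exists (S * K); [exact: alg_compactMl|exact: h1].
  by exists (K * S); [exact: alg_compactMr|exact: h2].
split; last by move=> S T AS cT; have [_ h] := ideal_mul _ _ AS cT; exact: h.
split; first by move=> T [].
- split.
  + split; first exact: alg0.
    move=> e e0; exists 0; first exact: alg_compact0.
    have e1 : 0 <= e by exact: ltW.
    apply: (nest_chain_locally Ns_nest); first exact: (@small_hereditary _ _ _ ip_norm _ Ns_nest).
    apply: (NestChainS (NestChain0 _ _)) => //; first exact: nestT.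
    by rewrite /small subrr compr0 rnorm0.
  + move=> S T [AS cS] [AT cT]; split; first exact: algD.
    move=> e e0; have e2 : 0 < e / 2 by lra.
    have [K cK SK] := cS _ e2; have [K' cK' TK'] := cT _ e2.
    exists (K + K'); first exact: alg_compactD.
    have -> : S + T - (K + K') = (S - K) + (T - K') by rewrite opprD addrACA.
    exact: (small_add e0 SK TK').
  + move=> c T cT; have -> : c *: T = ((c *: (1 : bop H)) : bop H) * T by apply: bopP.
    by have [h _] := ideal_mul (c *: (1 : bop H)) T (algZ Ns_nest (@alg1 _ _ Ns)) cT; exact: h.
- by move=> S T AS cT; have [h _] := ideal_mul _ _ AS cT; exact: h.
Qed.

Lemma locally_compact_closed : closed locally_compact_ideal.
Proof.
apply/closedP => T clT; split.
  have /closedP := nest_alg_closed Ns_nest; apply => e /clT[S [AS _] TS].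
  by exists S.
move=> e e0; have e2 : 0 < e / 2 by lra.
have [S [AS cS] TS] := clT _ e2; have [K cK SK] := cS _ e2.
exists K => //; apply: (nest_locally_mono _ SK) => M N NM NN MN; rewrite /small => h.
have -> : T - K = (T - S) + (S - K) by rewrite addrA subrK.
rewrite comprD; apply: le_trans (rnormD _ _) _; rewrite [e]splitr.
exact: lerD (le_trans (rnorm_compr ip_norm Ns_nest NM NN MN _) (ltW TS)) h.
Qed.

(** The correction from one approximant to the next is taken block diagonal,
    so that its norm is as small as that of the error. *)
Lemma locally_compact_step T K (e : R) : locally_compact_ideal T -> alg_compact K -> 0 < e ->
  nest_locally (small (T - K) e) ->
  exists K', [/\ alg_compact K', nest_locally (small (T - K') (e / 2)) & rnorm (K' - K) <= 2 * e].
Proof.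
move=> [AT cT] cK e0 TK; have e2 : 0 < e / 2 by lra.
have [K1 cK1 TK1] := cT _ e2.
have hs X c := @small_hereditary _ _ _ ip_norm _ Ns_nest X c.
have hI : hereditary Ns (fun M N => small (T - K) e M N /\ small (T - K1) (e / 2) M N).
  move=> M N M' N' NM NN NM' NN' MM' MN' NN1 [h1 h2].
  by split; [exact: (hs (T - K) e M N)|exact: (hs (T - K1) (e / 2) M N)].
have ch := nest_locally_chain Ns_nest hI
  (nest_locallyI Ns_nest (hs (T - K) e) (hs (T - K1) (e / 2)) TK TK1).
have e20 : 0 <= 2 * e by lra.
have chQ : nest_chain (fun M N => exists X, [/\ alg_compact X, rnorm (compr M N X) <= 2 * e &
    rnorm (compr M N (T - K) - compr M N X) <= e / 2]) [set: H].
  apply: (nest_chain_mono Ns_nest _ ch) => M N NM NN MN _ []; rewrite /small => h1 h2.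
  (* Globally [K1 - K] need not be small, but its compression to a cell is at most [e + e / 2]. *)
  exists (K1 - K); split; first exact: alg_compactB.
    have -> : K1 - K = (T - K) - (T - K1) by rewrite opprB [RHS]addrC subrKA.
    rewrite comprB; apply: le_trans (rnormB _ _) _.
    have -> : 2 * e = e + e by ring.
    by apply: lerD h1 (le_trans h2 _); lra.
  have -> : compr M N (T - K) - compr M N (K1 - K) = compr M N (T - K1).
    by rewrite -comprB opprB addrA subrK.
  exact: h2.
have [D [cD Dn _ chD]] := glue_blocks alg_compact0 alg_compactD alg_compact_compr e20
  (W := fun M N X => rnorm (compr M N (T - K) - X) <= e / 2) chQ.
exists (K + D); split; first exact: alg_compactD.
  apply: (nest_chain_locally Ns_nest) => //.
  apply: (nest_chain_mono Ns_nest _ chD) => M N NM NN MN _.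
  by rewrite /small -comprB opprD addrA.
rewrite addrC addrA addNr add0r; apply: rnorm_bop => [|v]; first lra.
by have := Dn v; rewrite (nprojT ip_norm Ns_nest) bop1E.
Qed.

(** Iterating the correction with errors [2^-1 ^+ n] gives a sequence converging in norm; its limit
    is compact, and each term shows that [T] minus the limit is locally small. *)
Lemma locally_compact_decomposition T : locally_compact_ideal T ->
  exists2 K, alg_compact K & jacobson_radical A (T - K).
Proof.
move=> lT; have [AT cT] := lT.
have p0 n : 0 < 2^-1 ^+ n :> R by rewrite exprn_gt0// invr_gt0.
pose good n K := alg_compact K /\ nest_locally (small (T - K) (2^-1 ^+ n)).
have /choice[f fP] (nK : nat * bop H) : exists K', good nK.1 nK.2 ->
    good nK.1.+1 K' /\ rnorm (K' - nK.2) <= 2 * 2^-1 ^+ nK.1.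
  have [[cK TK]|ngK] := pselect (good nK.1 nK.2); last by exists 0.
  have [K' [cK' TK' KK']] := locally_compact_step lT cK (p0 _) TK.
  by exists K' => _; split=> //; split=> //; rewrite exprSr.
have [K0 cK0 TK0] := cT _ (p0 0%N).
pose K := fix K n := if n is m.+1 then f (m, K m) else K0.
have gK n : good n (K n).
  by elim: n => [|n IH]; [split|have [] := fP (n, K n) IH].
have [|l [Kl lK]] := @geom_rcvg _ _ K 2 (bop_rcomplete (@complete_rcomplete _ H)).
  by move=> n; have [] := fP (n, K n) (gK n).
(* The factor 5 adds the local error 1 of [T - K n] to the 4 coming from the distance of [K n] to
   the limit, in units of [2^-1 ^+ n]. *)
have small_pow (e : R) : 0 < e -> exists n, 5 * 2^-1 ^+ n < e.
  move=> e0; have e5 : 0 < e / 5 by lra.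
  by have [N /(_ N (leqnn _)) h] := half_pow_lt e5; exists N; lra.
have Al : A l.
  by apply: rcvg_closed (nest_alg_closed Ns_nest) _ Kl => n; have [[]] := gK n.
exists l.
  split=> //; apply: compact_op_limit => e /small_pow[n ne].
  exists (K n); first by have [[]] := gK n.
  by rewrite rdistC; have := lK n; have := p0 n; lra.
apply: locally_small_radical; first exact: algB.
move=> e /small_pow[n ne].
have pe : 2^-1 ^+ n + 2 * 2 * 2^-1 ^+ n <= e by lra.
have [_ TK] := gK n.
apply: (nest_locally_mono _ TK) => M N NM NN MN; rewrite /small => h.
have -> : T - l = (T - K n) + (K n - l) by rewrite addrA subrK.
rewrite comprD; apply: le_trans (rnormD _ _) _.
have h' := le_trans (rnorm_compr ip_norm Ns_nest NM NN MN _) (lK n).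
exact: le_trans (lerD h h') pe.
Qed.

(** * Compact operators and the radical inside the generated ideal *)

Lemma compact_element_of_compact K : nest_compact Ns K -> compact_elements A K.
Proof.
rewrite nest_compactE => -[AK cK]; split=> //.
apply/(compact_map_onP (@complete_rcomplete _ H)).
apply: totally_bounded_subset (compact_op_two_sided cK).
by move=> _ [x [_ x1] <-]; exists x.
Qed.

Lemma compact_element_off_diagonal M N X : A X -> Ns M -> Ns N -> M `<=` N ->
  compact_elements A (P M * X * E M N).
Proof.
move=> AX NM NN MN; split.
  apply: algM; last exact: alg_nint.
  by apply: algM => //; exact: alg_nproj.
apply/(compact_map_onP (@complete_rcomplete _ H)) => e e0.
exists [:: 0] => _ [s [As _] <-]; exists 0; rewrite ?mem_head// subr0.
have -> : P M * X * E M N * s * (P M * X * E M N) = 0; last by rewrite rnorm0.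
have := upper_triangular As NM NN MN => h.
by rewrite -!mulrA (mulrA (E M N)) (mulrA (E M N * s)) h !(mul0r, mulr0).
Qed.

(** With zero diagonal blocks, each cell contributes only an off-diagonal corner, which is a compact
    element. *)
Lemma zero_diagonal_in_ideal (J : set (bop H)) X L : two_sided_ideal A J ->
  compact_elements A `<=` J -> A X -> nest_chain (fun M N => compr M N X = 0) L ->
  J (P L * X * P L).
Proof.
move=> [[_ [J0 JD _] _] _] cJ AX; elim=> [|N L' cN IH NL NsL cX].
  by rewrite (nproj0 ip_norm Ns_nest) !mul0r.
have NN := nest_chain_in Ns_nest cN.
rewrite (block_decomposition AX NN NL NsL) cX addr0; apply: JD => //.
by apply: cJ; exact: compact_element_off_diagonal.
Qed.

(** The diagonal blocks of [T] on a fine enough partition glue to an operator [D] of norm at most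
    [e / 2], and [T - D] has zero diagonal; as [J] is closed, these approximations suffice. *)
Lemma radical_in_ideal (J : set (bop H)) T : closed J -> two_sided_ideal A J ->
  compact_elements A `<=` J -> jacobson_radical A T -> J T.
Proof.
move=> cJ iJ ceJ radT; have [AT _] := radT.
move/closedP: cJ; apply => e e0; have e2 : 0 < e / 2 by lra.
have ch := nest_locally_chain Ns_nest (@small_hereditary _ _ _ ip_norm _ Ns_nest _ _)
  (radical_locally_small ip_norm Ns_nest radT e2).
have AE M N S : Ns M -> Ns N -> M `<=` N -> A S -> A (compr M N S).
  by move=> NM NN MN AS; exact: (alg_compr Ns_nest).
have chQ : nest_chain (fun M N => exists K, [/\ A K, rnorm (compr M N K) <= e / 2 &
    compr M N T = compr M N K]) [set: H].
  by apply: (nest_chain_mono Ns_nest _ ch) => M N NM NN MN _ sT; exists T.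
have [D [AD Dn _ chD]] := glue_blocks (alg0 Ns_nest) (@algD _ _ _ Ns_nest) AE (ltW e2)
  (W := fun M N X => compr M N T = X) chQ.
exists (T - D).
  have := zero_diagonal_in_ideal (L := [set: H]) iJ ceJ (algB Ns_nest AT AD).
  rewrite (nprojT ip_norm Ns_nest) mul1r mulr1; apply.
  by apply: (nest_chain_mono Ns_nest _ chD) => M N NM NN MN _; rewrite comprB => ->; rewrite subrr.
rewrite opprB addrC subrK; suff : rnorm D <= e / 2 by lra.
apply: rnorm_bop => [|v]; first exact: ltW.
by have := Dn v; rewrite (nprojT ip_norm Ns_nest) bop1E.
Qed.

End BlockDecomposition.

Theorem theorem3p2 (R : realType) (H : completeNormedModType R[i])
    (ip : {dot H for Num.conj}) (ip_norm : forall x : H, ip x x = `|x| ^+ 2)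
    (Ns : set (set H)) (Ns_nest : nest Ns) :
  closed_ideal_generated (nest_alg Ns) (compact_elements (nest_alg Ns)) =
  [set S + T | S in nest_compact Ns & T in jacobson_radical (nest_alg Ns)].
Proof.
apply/seteqP; split=> [T Jc|_ [S cS [T radT <-]] J [[cJ iJ] ceJ]].
  have lT : locally_compact_ideal ip_norm Ns T.
    apply: Jc; split; last by move=> K; exact: compact_element_locally.
    by split; [exact: locally_compact_closed|exact: locally_compact_two_sided].
  have [K cK radTK] := locally_compact_decomposition Ns_nest lT.
  exists K; first by rewrite nest_compactE.
  by exists (T - K) => //; rewrite addrC subrK.
have [[_ [_ JD _] _] _] := iJ; apply: JD; last first.
  exact: (radical_in_ideal ip_norm Ns_nest).
by apply: ceJ; exact: compact_element_of_compact.
Qed.
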